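(* Let $L$ be a Lie ring, $\gamma: L\to L$ a Lie ring endomorphism, and $r(t)=\sum_i a_it^i\in\mathbb{Z}[t]$ with $r(\gamma)=0_L$ (i.e. $\sum_i a_i\gamma^i(v)=0$ for all $v\in L$). Suppose $(L,+)$ has no $(\operatorname{Discr}_\ast(r(t))\cdot\operatorname{Prod}_\ast(r(t)))$-torsion. Then the Lie ring $\operatorname{Discr}_\ast(r(t))\cdot L$ can be embedded into a Lie ring $\overline{K}$ that is graded by the semigroup $(\overline{\mathbb{Q}},\cdot)$ and whose support is contained in the set $X$ of roots of $r(t)$ in $\overline{\mathbb{Q}}$.
   Context: A Lie ring $K$ is graded by a semigroup $(S,\cdot)$ if $K=\bigoplus_{s\in S}K_s$ as additive groups with $[K_s,K_{s'}]\subseteq K_{s s'}$; its support is $\{s: K_s\ne0\}$. If $r$ is constant, $\operatorname{Discr}_\ast(r):=r$, $\operatorname{Prod}_\ast(r):=1$. Otherwise, with $d=\deg r$, leading coefficient $a$, distinct roots $\lambda_1,\dots,\lambda_l\in\overline{\mathbb{Q}}$ of multiplicities $m_i$, $m=\max m_i$: $\operatorname{Discr}_\ast(r):=a^{1+2d^2}(m-1)!\prod_{i\ne j}(\lambda_i-\lambda_j)^m$ and $\operatorname{Prod}_\ast(r):=a^{2d^3}\prod_{1\le i,j\le l,\ r(\lambda_i\lambda_j)\ne0}r(\lambda_i\lambda_j)$. $(L,+)$ has $n$-torsion if some nonzero $v$ satisfies $nv=0$. *)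

(* Defs.v *)
From mathcomp Require Import all_boot all_order all_algebra all_field.
Set Implicit Arguments. Unset Strict Implicit. Unset Printing Implicit Defensive.
Import Order.TTheory GRing.Theory Num.Theory.
Local Open Scope ring_scope.

Definition is_lie_ring (L : zmodType) (br : L -> L -> L) : Prop :=
  [/\ (forall x y z, br (x + y) z = br x z + br y z),
      (forall x y z, br x (y + z) = br x y + br x z),
      (forall x, br x x = 0) &
      (forall x y z, br x (br y z) + br y (br z x) + br z (br x y) = 0)].

Definition lie_endo (L : zmodType) (br : L -> L -> L) (g : L -> L) : Prop :=
  (forall x y, g (x + y) = g x + g y) /\ (forall x y, g (br x y) = br (g x) (g y)).

Definition poly_annihilates (L : zmodType) (r : {poly int}) (g : L -> L) : Prop :=
  forall v : L, \sum_(i < size r) (iter i g v) *~ r`_i = 0.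

Definition has_torsion (L : zmodType) (n : int) : Prop :=
  exists v : L, v != 0 /\ v *~ n = 0.

Definition rC (r : {poly int}) : {poly algC} := map_poly (fun z : int => z%:~R) r.

Definition roots_mult (r : {poly int}) : seq algC :=
  sval (closed_field_poly_normal (rC r)).

Definition droots (r : {poly int}) : seq algC := undup (roots_mult r).

Definition maxmult (r : {poly int}) : nat :=
  \max_(z <- droots r) count_mem z (roots_mult r).

Definition is_constant (r : {poly int}) : bool := (size r <= 1)%N.

Definition discr_star (r : {poly int}) : algC :=
  if is_constant r then (r`_0)%:~R
  else let a : algC := (lead_coef r)%:~R in
       let d := (size r).-1 in
       let m := maxmult r in
       a ^+ (1 + 2 * d ^ 2) * ((m.-1)`!)%:R *
       \prod_(x <- droots r) \prod_(y <- droots r | x != y) (x - y) ^+ m.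

Definition prod_star (r : {poly int}) : algC :=
  if is_constant r then 1
  else let a : algC := (lead_coef r)%:~R in
       let d := (size r).-1 in
       a ^+ (2 * d ^ 3) *
       \prod_(x <- droots r) \prod_(y <- droots r | (rC r).[x * y] != 0)
          (rC r).[x * y].

Definition is_grading (K : zmodType) (br : K -> K -> K) (Ks : algC -> K -> Prop) : Prop :=
  [/\ (forall s, Ks s 0 /\ forall x y, Ks s x -> Ks s y -> Ks s (x - y)),
      (forall v : K, exists (S : seq algC) (x : algC -> K),
          (forall t, t \in S -> Ks t (x t)) /\ v = \sum_(t <- S) x t),
      (forall (S : seq algC) (x : algC -> K), uniq S ->
          (forall t, t \in S -> Ks t (x t)) -> \sum_(t <- S) x t = 0 ->
          forall t, t \in S -> x t = 0) &
      (forall s s' x y, Ks s x -> Ks s' y -> Ks (s * s') (br x y))].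

Definition in_support (K : zmodType) (Ks : algC -> K -> Prop) (s : algC) : Prop :=
  exists x, Ks s x /\ x != 0.

Definition in_mulL (L : zmodType) (D : int) (x : L) : Prop := exists v : L, x = v *~ D.

(* Main.v *)
Require Import Defs.
From HB Require Import structures.
From Stdlib Require Import Classical_Prop.
From mathcomp Require Import all_boot all_order all_algebra all_field.
From mathcomp Require Import generic_quotient ring.
Set Implicit Arguments. Unset Strict Implicit. Unset Printing Implicit Defensive.
Import Order.TTheory GRing.Theory Num.Theory.
Local Open Scope ring_scope.

(* Let a be the leading coefficient of r and n = Discr_*(r) Prod_*(r). Since a
   times any product of distinct roots of r is an algebraic integer, a divides
   Discr_*(r). The numbers a λ, for λ a root, generate a ring S of algebraic
   integers which is a finitely generated free Z-module, so that L embeds into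
   L[1/n] ⊗ S. There a, the a (λ - μ) with λ <> μ and the a^2 (λ μ - ν) with λ μ
   not a root are invertible because they divide a power of n. Hence this module
   is the direct sum of the generalized eigenspaces of γ, and the bracket of the
   eigenspaces of λ and μ lies in that of λ μ, which is 0 if λ μ is not a root. *)

(** The roots λ need not be algebraic integers, so a ring S that is finitely generated as a Z-module
    can be expected to contain only the a λ, and γ gives way to a γ. Since [a γ x, a γ y] = a^2 γ
    [x, y], brackets of eigenvectors are studied under a^2 γ, with eigenvalue (a λ)(a μ); the
    surplus factors a are cancelled because a is invertible. The exponents in Discr_* provide this
    invertibility. With d the degree of r and m its largest root multiplicity, the product of the λ
    - μ becomes integral after multiplication by a^(2d), and its m-th power after multiplication by
    a^(2dm). As m ≤ d, the factor a^(2d^2) clears all denominators and one factor a is left over.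
    Injectivity of n suffices for the eigenspaces to be independent. For them to span, n is
    inverted: then (a γ - a μ) z = y has a solution z in the generalized eigenspace of y when y
    belongs to a root λ ≠ μ. *)

Section AdditiveFunctions.
Variables (U V : zmodType) (f : U -> V).
Hypothesis fD : forall x y, f (x + y) = f x + f y.

Lemma additive0 : f 0 = 0.
Proof. by apply: (addrI (f 0)); rewrite -fD !addr0. Qed.

Lemma additiveN x : f (- x) = - f x.
Proof. by apply: (addrI (f x)); rewrite -fD !subrr additive0. Qed.

Lemma additiveB x y : f (x - y) = f x - f y.
Proof. by rewrite fD additiveN. Qed.

Lemma additiveMn x k : f (x *+ k) = f x *+ k.
Proof. by elim: k => [|k IHk]; rewrite ?additive0 // !mulrS fD IHk. Qed.

Lemma additiveMz x k : f (x *~ k) = f x *~ k.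
Proof.
by case: k => k; rewrite ?NegzE ?mulrNz -?pmulrn ?additiveN additiveMn.
Qed.

Lemma additive_sum (I : Type) (s : seq I) (P : pred I) (F : I -> U) :
  f (\sum_(i <- s | P i) F i) = \sum_(i <- s | P i) f (F i).
Proof. exact: (big_morph f fD additive0). Qed.

End AdditiveFunctions.

Section SubringClosure.
Variables (R : pzRingType) (S : {pred R}).
Hypothesis ringS : subring_closed S.

Lemma subring1 : 1 \in S. Proof. by case: ringS. Qed.

Lemma subringB z w : z \in S -> w \in S -> z - w \in S.
Proof. by case: ringS => _ h _ zS wS; apply: h. Qed.

Lemma subringM z w : z \in S -> w \in S -> z * w \in S.
Proof. by case: ringS => _ _ h zS wS; apply: h. Qed.

Lemma subring0 : 0 \in S.
Proof. by rewrite -(subrr 1) subringB ?subring1. Qed.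

Lemma subringN z : z \in S -> - z \in S.
Proof. by rewrite -sub0r; apply/subringB/subring0. Qed.

Lemma subringD z w : z \in S -> w \in S -> z + w \in S.
Proof. by move=> zS wS; rewrite -[w]opprK subringB ?subringN. Qed.

Lemma subringMn z k : z \in S -> z *+ k \in S.
Proof.
by move=> zS; elim: k => [|k IHk]; rewrite ?subring0 // mulrS subringD.
Qed.

Lemma subringMz z k : z \in S -> z *~ k \in S.
Proof.
by case: k => k zS; rewrite ?NegzE ?mulrNz -?pmulrn ?subringN // subringMn.
Qed.

Lemma subring_int k : k%:~R \in S.
Proof. exact/subringMz/subring1. Qed.

Lemma subringX z k : z \in S -> z ^+ k \in S.
Proof.
by move=> zS; elim: k => [|k IHk]; rewrite ?subring1 // exprS subringM.
Qed.

Lemma subring_sum (I : Type) (s : seq I) (F : I -> R) :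
  (forall i, F i \in S) -> \sum_(i <- s) F i \in S.
Proof.
by move=> FS; elim/big_rec: _ => [|i x _]; [apply: subring0|apply: subringD].
Qed.

Lemma subring_prod (I : eqType) (s : seq I) (Q : pred I) (F : I -> R) :
  (forall i, i \in s -> F i \in S) -> \prod_(i <- s | Q i) F i \in S.
Proof.
move=> FS; rewrite big_seq_cond.
elim/big_rec: _ => [|i c /andP[si _]]; first exact: subring1.
by apply: subringM; apply: FS.
Qed.

End SubringClosure.

Section LieRing.
Variables (L : zmodType) (br : L -> L -> L).
Hypothesis brL : is_lie_ring br.

Lemma lieDl x y z : br (x + y) z = br x z + br y z.
Proof. by case: brL. Qed.

Lemma lieDr x y z : br x (y + z) = br x y + br x z.
Proof. by case: brL. Qed.

Lemma lie0l y : br 0 y = 0.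
Proof. exact: (additive0 (fun u v => lieDl u v y)). Qed.

Lemma lie0r x : br x 0 = 0.
Proof. exact: (additive0 (lieDr x)). Qed.

Lemma lieMzl x y k : br (x *~ k) y = br x y *~ k.
Proof. exact: (additiveMz (fun u v => lieDl u v y)). Qed.

Lemma lieMzr x y k : br x (y *~ k) = br x y *~ k.
Proof. exact: (additiveMz (lieDr x)). Qed.

Lemma lieN x y : br x y = - br y x.
Proof.
case: brL => _ _ alt _; apply/eqP; rewrite -addr_eq0.
by have := alt (x + y); rewrite lieDl !lieDr !alt add0r addr0 => ->.
Qed.

End LieRing.

Lemma mulrz_exp_inj (L : zmodType) (n : int) (k : nat) (x : L) :
  (forall y : L, y *~ n = 0 -> y = 0) -> x *~ n ^+ k = 0 -> x = 0.
Proof.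
move=> n_inj; elim: k => [|k IHk]; first by rewrite expr0 mulr1z.
by rewrite exprSr mulrzA => /n_inj.
Qed.

(** * Localization of an abelian group at n *)

Section Localization.
Local Open Scope quotient_scope.

Variables (L : zmodType) (n : int).
Hypothesis n_inj : forall x : L, x *~ n = 0 -> x = 0.

(** The pair (x, k) stands for x / n^k. Cross-multiplication without a further power of n is
    transitive because n acts injectively. *)
Definition fraceq (p q : L * nat) := p.1 *~ n ^+ q.2 == q.1 *~ n ^+ p.2.

Lemma mulrz_expI k (x y : L) : x *~ n ^+ k = y *~ n ^+ k -> x = y.
Proof.
move/eqP; rewrite -subr_eq0 -mulrzBl => /eqP/(mulrz_exp_inj n_inj)/eqP.
by rewrite subr_eq0 => /eqP.
Qed.

Lemma fraceq_refl : reflexive fraceq.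
Proof. by move=> p; apply: eqxx. Qed.

Lemma fraceq_sym : symmetric fraceq.
Proof. by move=> p q; apply: eq_sym. Qed.

Lemma fraceq_trans : transitive fraceq.
Proof.
move=> q p s /eqP pq /eqP qs; apply/eqP/(@mulrz_expI q.2).
by rewrite -mulrzA mulrC mulrzA pq -mulrzA mulrC mulrzA qs -!mulrzA mulrC.
Qed.

Canonical fraceq_equiv :=
  EquivRel fraceq fraceq_refl fraceq_sym fraceq_trans.

Definition locT := {eq_quot fraceq}.
HB.instance Definition _ : EqQuotient _ fraceq locT := EqQuotient.on locT.
HB.instance Definition _ := Choice.on locT.

Lemma loc_pi_eq (p q : L * nat) :
  (p.1 *~ n ^+ q.2 = q.1 *~ n ^+ p.2) <-> (\pi_locT p = \pi_locT q).
Proof.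
by split=> [/eqP pq|/eqmodP/eqP //]; apply/eqmodP.
Qed.

Lemma repr_pi (p : L * nat) :
  (repr (\pi_locT p)).1 *~ n ^+ p.2 = p.1 *~ n ^+ (repr (\pi_locT p)).2.
Proof. by apply/loc_pi_eq; rewrite reprK. Qed.

Definition loc_zero : locT := \pi_locT (0, 0%N).
Definition loc_add (u v : locT) : locT :=
  \pi_locT ((repr u).1 *~ n ^+ (repr v).2 + (repr v).1 *~ n ^+ (repr u).2,
       ((repr u).2 + (repr v).2)%N).
Definition loc_opp (u : locT) : locT := \pi_locT (- (repr u).1, (repr u).2).

Lemma loc_pi_add (p q : L * nat) : loc_add (\pi_locT p) (\pi_locT q) =
  \pi_locT (p.1 *~ n ^+ q.2 + q.1 *~ n ^+ p.2, (p.2 + q.2)%N).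
Proof.
apply/loc_pi_eq => /=; rewrite !mulrzDl -!mulrzA !exprD.
have hp := repr_pi p; have hq := repr_pi q.
set a := repr _ in hp *; set b := repr _ in hq *.
congr (_ + _).
  transitivity (a.1 *~ n ^+ p.2 *~ (n ^+ b.2 * n ^+ q.2)).
    by rewrite -mulrzA; congr (_ *~ _); ring.
  by rewrite hp -mulrzA; congr (_ *~ _); ring.
transitivity (b.1 *~ n ^+ q.2 *~ (n ^+ a.2 * n ^+ p.2)).
  by rewrite -mulrzA; congr (_ *~ _); ring.
by rewrite hq -mulrzA; congr (_ *~ _); ring.
Qed.

Lemma loc_pi_opp (p : L * nat) : loc_opp (\pi_locT p) = \pi_locT (- p.1, p.2).
Proof. by apply/loc_pi_eq => /=; rewrite !mulNrz repr_pi. Qed.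

Lemma loc_addA : associative loc_add.
Proof.
elim/quotW=> x; elim/quotW=> y; elim/quotW=> z.
rewrite (loc_pi_add y z) (loc_pi_add x y).
rewrite (loc_pi_add x (_, _)) (loc_pi_add (_, _) z).
rewrite /= addnA; congr (\pi_locT (_, _)).
rewrite !mulrzDl -!mulrzA !exprD addrA.
by congr (_ + _ + _); congr (_ *~ _); ring.
Qed.

Lemma loc_addC : commutative loc_add.
Proof.
by elim/quotW=> x; elim/quotW=> y; rewrite !loc_pi_add addrC addnC.
Qed.

Lemma loc_add0 : left_id loc_zero loc_add.
Proof.
elim/quotW=> x; rewrite loc_pi_add /= mul0rz add0r expr0 mulr1z add0n.
by case: x.
Qed.

Lemma loc_addN : left_inverse loc_zero loc_opp loc_add.
Proof.
elim/quotW=> x; rewrite loc_pi_opp loc_pi_add /=.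
by apply/loc_pi_eq; rewrite /= mulNrz addNr !mul0rz.
Qed.

HB.instance Definition _ :=
  GRing.isZmodule.Build locT loc_addA loc_addC loc_add0 loc_addN.

Lemma loc_pi_mulrz (p : L * nat) k : (\pi_locT p) *~ k = \pi_locT (p.1 *~ k, p.2).
Proof.
have pin m : (\pi_locT p) *+ m = \pi_locT (p.1 *+ m, p.2).
  elim: m => [|m IHm].
    by rewrite !mulr0n; apply/loc_pi_eq => /=; rewrite !mul0rz.
  rewrite mulrS IHm [LHS]loc_pi_add; apply/loc_pi_eq => /=.
  by rewrite mulrS exprD !mulrzDl -!mulrzA [n ^+ p.2 * _]mulrC.
case: k => k; first exact: pin.
by rewrite !NegzE !mulrNz -!pmulrn pin [LHS]loc_pi_opp.
Qed.

End Localization.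

(** An interface that hides the quotient type: [num u] and [den u] form a fraction for u, and
    [quo u k] is u / n^k. *)
Lemma localization_exists (L : zmodType) (n : int) :
    (forall x : L, x *~ n = 0 -> x = 0) ->
  exists (L1 : zmodType) (j : L -> L1) (num : L1 -> L) (den : L1 -> nat)
         (quo : L1 -> nat -> L1),
  [/\ (forall x y, j (x + y) = j x + j y),
      injective j,
      (forall u : L1, u *~ n = 0 -> u = 0),
      (forall u, u *~ n ^+ den u = j (num u)) &
      (forall u k, quo u k *~ n ^+ k = u)].
Proof.
move=> n_inj; exists (locT n_inj : zmodType).
exists (fun x => \pi_(locT n_inj)%qT (x, 0%N)).
exists (fun u => (repr u).1), (fun u => (repr u).2).
exists (fun u k => \pi_(locT n_inj)%qT ((repr u).1, ((repr u).2 + k)%N)).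
split.
- by move=> x y; rewrite [RHS]loc_pi_add /= expr0 !mulr1z.
- by move=> x y /loc_pi_eq /=; rewrite expr0 !mulr1z.
- elim/quotW=> p; rewrite loc_pi_mulrz => /loc_pi_eq /=.
  rewrite mul0rz expr0 mulr1z => /n_inj p0.
  by apply/loc_pi_eq; rewrite /= p0 !mul0rz.
- move=> u; rewrite -{1}[u]reprK loc_pi_mulrz.
  by apply/loc_pi_eq; rewrite /= expr0 mulr1z.
- move=> u k; rewrite -[RHS]reprK loc_pi_mulrz.
  by apply/loc_pi_eq; rewrite /= -mulrzA exprD mulrC.
Qed.

(** * The Lie ring L[1/n] and its endomorphism *)

Section LieLocalization.
Variables (L : zmodType) (br : L -> L -> L) (gamma : L -> L).
Hypotheses (brL : is_lie_ring br) (gammaL : lie_endo br gamma).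

Let brDl := lieDl brL.
Let brDr := lieDr brL.

Let brMzl := lieMzl brL.
Let brMzr := lieMzr brL.
Let gammaD x y : gamma (x + y) = gamma x + gamma y.
Proof. by case: gammaL. Qed.

Lemma lie_localization (r : {poly int}) (n : int) :
    (forall x : L, x *~ n = 0 -> x = 0) -> poly_annihilates r gamma ->
  exists (L1 : zmodType) (br1 : L1 -> L1 -> L1) (gamma1 : L1 -> L1)
         (j : L -> L1),
  [/\ is_lie_ring br1, lie_endo br1 gamma1, poly_annihilates r gamma1,
      (forall u : L1, u *~ n = 0 -> u = 0) /\
      (forall u : L1, exists v, v *~ n = u) &
   [/\ (forall x y, j (x + y) = j x + j y),
       (forall x y, j (br x y) = br1 (j x) (j y)) &
       injective j]].
Proof.
move=> n_inj rgamma.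
have [L1 [j [num [den [quo]]]]] := localization_exists n_inj.
case=> jD j_inj n_inj1 numP quoP.
have expI k (u v : L1) : u *~ n ^+ k = v *~ n ^+ k -> u = v.
  exact: (mulrz_expI n_inj1).
have jMz x k : j (x *~ k) = j x *~ k by exact: additiveMz.
(* The bracket is computed on arbitrarily chosen numerators. [br1P] and [g1P] remove the choice: any
   fractions for the arguments give a fraction for the value, so each law can be checked in [L]
   after clearing denominators. *)
pose br1 u v := quo (j (br (num u) (num v))) (den u + den v)%N.
pose g1 u := quo (j (gamma (num u))) (den u).
have numE u k x : u *~ n ^+ k = j x -> num u *~ n ^+ k = x *~ n ^+ den u.
  by move=> ux; apply: j_inj; rewrite !jMz -numP -ux -!mulrzA mulrC.
have br1P u v k l x y : u *~ n ^+ k = j x -> v *~ n ^+ l = j y ->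
    br1 u v *~ n ^+ (k + l) = j (br x y).
  move=> ux vy; apply: (@expI (den u + den v)%N).
  rewrite -mulrzA mulrC mulrzA quoP -!jMz; congr j.
  rewrite !exprD !mulrzA -brMzl -brMzr (numE _ _ _ ux) (numE _ _ _ vy).
  by rewrite brMzr brMzl.
have g1P u k x : u *~ n ^+ k = j x -> g1 u *~ n ^+ k = j (gamma x).
  move=> ux; apply: (@expI (den u)).
  rewrite -mulrzA mulrC mulrzA quoP -!jMz; congr j.
  by rewrite -!(additiveMz gammaD) (numE _ _ _ ux).
(* Over a common denominator n^k the numerators of a sum add up. *)
have common u v w : exists k x y z,
    [/\ u *~ n ^+ k = j x, v *~ n ^+ k = j y & w *~ n ^+ k = j z].
  exists (den u + den v + den w)%N.
  exists (num u *~ n ^+ (den v + den w)), (num v *~ n ^+ (den u + den w)).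
  exists (num w *~ n ^+ (den u + den v)).
  by rewrite !jMz -!numP -!mulrzA !exprD; split; congr (_ *~ _); ring.
have common2 u v : exists k x y, u *~ n ^+ k = j x /\ v *~ n ^+ k = j y.
  by have [k [x [y [z [? ? _]]]]] := common u v 0; exists k, x, y.
have add_k u v k x y : u *~ n ^+ k = j x -> v *~ n ^+ k = j y ->
    (u + v) *~ n ^+ k = j (x + y).
  by move=> ux vy; rewrite mulrzDl ux vy jD.
have j0 : j 0 = 0 by exact: additive0.
have jk x : j x *~ n ^+ 0 = j x by rewrite expr0 mulr1z.
have g1D u v : g1 (u + v) = g1 u + g1 v.
  have [k [x [y [ux vy]]]] := common2 u v; apply: (@expI k).
  by rewrite (g1P _ _ _ (add_k _ _ _ _ _ ux vy)) mulrzDl !(g1P _ _ _ ux,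
    g1P _ _ _ vy) gammaD jD.
have iter1P i u k x : u *~ n ^+ k = j x ->
    iter i g1 u *~ n ^+ k = j (iter i gamma x).
  by move=> ux; elim: i => //= i /g1P.
exists L1, br1, g1, j; split; [split| | | |split] => //.
- move=> u v w; have [k [x [y [z [ux vy wz]]]]] := common u v w.
  apply: (@expI (k + k)%N); rewrite mulrzDl (br1P _ _ _ _ _ _ ux wz).
  rewrite (br1P _ _ _ _ _ _ vy wz).
  by rewrite (br1P _ _ _ _ _ _ (add_k _ _ _ _ _ ux vy) wz) brDl jD.
- move=> u v w; have [k [x [y [z [ux vy wz]]]]] := common u v w.
  apply: (@expI (k + k)%N); rewrite mulrzDl (br1P _ _ _ _ _ _ ux wz).
  rewrite (br1P _ _ _ _ _ _ ux vy).
  by rewrite (br1P _ _ _ _ _ _ ux (add_k _ _ _ _ _ vy wz)) brDr jD.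
- move=> u; apply: (@expI (den u + den u)%N).
  rewrite (br1P _ _ _ _ _ _ (numP u) (numP u)) mul0rz.
  by case: brL => _ _ -> _.
- move=> u v w; have [k [x [y [z [ux vy wz]]]]] := common u v w.
  apply: (@expI (k + (k + k))%N); rewrite !mulrzDl mul0rz.
  rewrite (br1P _ _ _ _ _ _ ux (br1P _ _ _ _ _ _ vy wz)).
  rewrite (br1P _ _ _ _ _ _ vy (br1P _ _ _ _ _ _ wz ux)).
  rewrite (br1P _ _ _ _ _ _ wz (br1P _ _ _ _ _ _ ux vy)) -!jD.
  by case: brL => _ _ _ ->.
- split=> // u v; have [k [x [y [ux vy]]]] := common2 u v.
  apply: (@expI (k + k)%N).
  rewrite (g1P _ _ _ (br1P _ _ _ _ _ _ ux vy)).
  rewrite (br1P _ _ _ _ _ _ (g1P _ _ _ ux) (g1P _ _ _ vy)).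
  by case: gammaL => _ ->.
- move=> u; apply: (@expI (den u)); rewrite mul0rz.
  rewrite -[RHS]j0 -[in RHS](rgamma (num u)) (additive_sum jD).
  rewrite (additive_sum (mulrzDl (n ^+ den u))).
  apply: eq_bigr => i _.
  by rewrite -mulrzA mulrC mulrzA (iter1P _ _ _ _ (numP u)) jMz.
- by split=> // u; exists (quo u 1%N); rewrite -[n]expr1 quoP.
- move=> x y; rewrite -[LHS]jk -(br1P _ _ _ _ _ _ (jk x) (jk y)).
  by rewrite expr0 !mulr1z.
Qed.

End LieLocalization.

(** * Extension of scalars from Z to S *)

(* [cz] gives the coordinates of an element of the order [S] in its Z-basis [e],
   so that [{ffun 'I_N -> L}] is L ⊗ S and [pure x z] is x ⊗ z. *)
Section ScalarExtension.
Variables (S : {pred algC}) (N : nat) (e : 'I_N -> algC).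
Variable cz : algC -> 'I_N -> int.
Hypothesis ringS : subring_closed S.
Hypothesis eS : forall i, e i \in S.
Hypothesis czP : forall z, z \in S -> z = \sum_i e i *~ cz z i.
Hypothesis e_free : forall a b : 'I_N -> int,
  \sum_i e i *~ a i = \sum_i e i *~ b i -> a =1 b.

Let S1 := subring1 ringS.
Let SM := subringM ringS.
Let SD := subringD ringS.

Lemma coordD z w i : z \in S -> w \in S -> cz (z + w) i = cz z i + cz w i.
Proof.
move=> zS wS; apply: (e_free (a := cz (z + w)) (b := fun k => _ + _)).
rewrite -czP ?SD //.
under eq_bigr do rewrite mulrzDr.
by rewrite big_split /= -!czP.
Qed.

Lemma coord_basis i k : cz (e i) k = (i == k).
Proof.
apply: (e_free (a := cz (e i)) (b := fun k => Posz (i == k))).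
rewrite -czP // (bigD1 i) //= eqxx mulr1z big1 ?addr0 // => j.
by rewrite eq_sym => /negPf->; rewrite mulr0z.
Qed.

Variables (L : zmodType) (br : L -> L -> L) (gamma : L -> L).
Hypotheses (brL : is_lie_ring br) (gammaL : lie_endo br gamma).

Let brDl := lieDl brL.
Let brDr := lieDr brL.
Let brMzl := lieMzl brL.
Let brMzr := lieMzr brL.
Let gammaD x y : gamma (x + y) = gamma x + gamma y.
Proof. by case: gammaL. Qed.

Local Notation M := {ffun 'I_N -> L}.

Definition pure (x : L) (z : algC) : M := [ffun k => x *~ cz z k].
(** Since m is the sum of the m_i ⊗ e_i, [scal] and [brM] extend c (x ⊗ z) = x ⊗ c z and
    [x ⊗ z, y ⊗ w] = [x, y] ⊗ z w additively from the basis; [pure] expands the products again in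
    coordinates. *)
Definition scal (c : algC) (m : M) : M := \sum_i pure (m i) (c * e i).
Definition brM (m m' : M) : M :=
  \sum_i \sum_j pure (br (m i) (m' j)) (e i * e j).
Definition gammaM (m : M) : M := [ffun k => gamma (m k)].

Lemma pureDl z x y : pure (x + y) z = pure x z + pure y z.
Proof. by apply/ffunP=> k; rewrite !ffunE mulrzDl. Qed.

Lemma pureDr x z w : z \in S -> w \in S -> pure x (z + w) = pure x z + pure x w.
Proof. by move=> zS wS; apply/ffunP=> k; rewrite !ffunE coordD // mulrzDr. Qed.

Let S0 := subring0 ringS.
Let SN := subringN ringS.
Let SMn := subringMn ringS.
Let SMz := subringMz ringS.
Let Ssum := subring_sum ringS.

Lemma pure0r x : pure x 0 = 0.
Proof. by apply: (addrI (pure x 0)); rewrite -pureDr // !addr0. Qed.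

Lemma pureNr x z : z \in S -> pure x (- z) = - pure x z.
Proof.
by move=> zS; apply: (addrI (pure x z)); rewrite -pureDr ?SN // !subrr pure0r.
Qed.

Lemma pureMzr x z k : z \in S -> pure x (z *~ k) = pure (x *~ k) z.
Proof.
move=> zS; rewrite (additiveMz (pureDl z)).
have pureMn i : pure x (z *+ i) = pure x z *+ i.
  elim: i => [|i IHi]; first exact: pure0r.
  by rewrite !mulrS pureDr ?SMn // IHi.
case: k => k; rewrite ?NegzE ?mulrNz -?pmulrn ?pureNr ?SMn //.
all: by rewrite pureMn.
Qed.

Lemma pure_sumr x (I : Type) (s : seq I) (F : I -> algC) :
  (forall i, F i \in S) ->
  pure x (\sum_(i <- s) F i) = \sum_(i <- s) pure x (F i).
Proof.
move=> FS; elim: s => [|i s IHs]; first by rewrite !big_nil pure0r.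
by rewrite !big_cons pureDr ?Ssum // IHs.
Qed.

Lemma pure_basis (m : M) : m = \sum_i pure (m i) (e i).
Proof.
apply/ffunP=> k; rewrite sum_ffunE (bigD1 k) //= big1 => [|i ik].
  by rewrite ffunE coord_basis eqxx mulr1z addr0.
by rewrite ffunE coord_basis (negPf ik) mulr0z.
Qed.

(** The laws of the tensor product are additive in each argument, so this reduces them to pure
    tensors, where they come from [L] and S. *)
Lemma pure_ind (Q : M -> Prop) :
    (forall m m', Q m -> Q m' -> Q (m + m')) ->
    (forall x z, z \in S -> Q (pure x z)) ->
  forall m, Q m.
Proof.
move=> QD Qp m; rewrite (pure_basis m).
elim/big_rec: _ => [|i m' _ IHm]; first by rewrite -(pure0r 0); apply: Qp.
by apply: QD => //; apply: Qp.
Qed.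

Lemma scalDr c m m' : scal c (m + m') = scal c m + scal c m'.
Proof.
by rewrite -big_split; apply: eq_bigr => i _; rewrite ffunE pureDl.
Qed.

Lemma scal_pure c x z : c \in S -> z \in S -> scal c (pure x z) = pure x (c * z).
Proof.
move=> cS zS; rewrite {2}(czP zS) mulr_sumr pure_sumr => [|i]; last first.
  by rewrite SM ?SMz.
by apply: eq_bigr => i _; rewrite ffunE mulrzAr pureMzr ?SM.
Qed.

Lemma brMDl m m' w : brM (m + m') w = brM m w + brM m' w.
Proof.
rewrite -big_split; apply: eq_bigr => i _.
by rewrite -big_split; apply: eq_bigr => j _; rewrite ffunE brDl pureDl.
Qed.

Lemma brMDr w m m' : brM w (m + m') = brM w m + brM w m'.
Proof.
rewrite -big_split; apply: eq_bigr => i _.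
by rewrite -big_split; apply: eq_bigr => j _; rewrite ffunE brDr pureDl.
Qed.

Lemma brM_pure x z y w : z \in S -> w \in S ->
  brM (pure x z) (pure y w) = pure (br x y) (z * w).
Proof.
move=> zS wS; rewrite {2}(czP zS) mulr_suml pure_sumr => [|i]; last first.
  by rewrite SM ?SMz.
apply: eq_bigr => i _; rewrite {2}(czP wS) mulr_sumr pure_sumr => [|j].
  apply: eq_bigr => j _; rewrite !ffunE brMzl brMzr.
  by rewrite mulrzAr mulrzAl !pureMzr ?SMz ?SM // -!mulrzA mulrC.
by rewrite SM ?SMz.
Qed.

Lemma gammaMD m m' : gammaM (m + m') = gammaM m + gammaM m'.
Proof. by apply/ffunP=> k; rewrite !ffunE gammaD. Qed.

Lemma gammaM_pure x z : gammaM (pure x z) = pure (gamma x) z.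
Proof. by apply/ffunP=> k; rewrite !ffunE additiveMz. Qed.

Lemma scalDl c d m : c \in S -> d \in S -> scal (c + d) m = scal c m + scal d m.
Proof.
move=> cS dS; elim/pure_ind: m => [m m' IH IH'|x z zS].
  by rewrite !scalDr IH IH' addrACA.
by rewrite !scal_pure ?SD // mulrDl pureDr ?SM.
Qed.

Lemma scalM c d m : c \in S -> d \in S -> scal (c * d) m = scal c (scal d m).
Proof.
move=> cS dS; elim/pure_ind: m => [m m' IH IH'|x z zS].
  by rewrite !scalDr IH IH'.
by rewrite !scal_pure ?SM // mulrA.
Qed.

Lemma scal1 m : scal 1 m = m.
Proof.
elim/pure_ind: m => [m m' IH IH'|x z zS]; first by rewrite scalDr IH IH'.
by rewrite scal_pure // mul1r.
Qed.

Lemma gammaM_scal c m : c \in S -> gammaM (scal c m) = scal c (gammaM m).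
Proof.
move=> cS; elim/pure_ind: m => [m m' IH IH'|x z zS].
  by rewrite !(scalDr, gammaMD) IH IH'.
by rewrite scal_pure // !gammaM_pure scal_pure.
Qed.

Lemma brM_scall c m m' : c \in S -> brM (scal c m) m' = scal c (brM m m').
Proof.
move=> cS; elim/pure_ind: m => [m1 m2 IH IH'|x z zS].
  by rewrite !(scalDr, brMDl) IH IH'.
elim/pure_ind: m' => [m1 m2 IH IH'|y w wS].
  by rewrite !(scalDr, brMDr) IH IH'.
by rewrite !(brM_pure, scal_pure) ?SM // mulrA.
Qed.

Lemma brM_scalr c m m' : c \in S -> brM m (scal c m') = scal c (brM m m').
Proof.
move=> cS; elim/pure_ind: m => [m1 m2 IH IH'|x z zS].
  by rewrite !(scalDr, brMDl) IH IH'.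
elim/pure_ind: m' => [m1 m2 IH IH'|y w wS].
  by rewrite !(scalDr, brMDr) IH IH'.
by rewrite !(brM_pure, scal_pure) ?SM // mulrCA.
Qed.

Let brN := lieN brL.

Lemma brM_lie : is_lie_ring brM.
Proof.
(* The condition [m, m] = 0 is not additive in m: a sum produces cross terms, which cancel by
   antisymmetry. Hence antisymmetry is proved first. *)
have brMN m m' : brM m m' = - brM m' m.
  elim/pure_ind: m => [m1 m2 IH IH'|x z zS].
    by rewrite brMDl brMDr IH IH' opprD.
  elim/pure_ind: m' => [m1 m2 IH IH'|y w wS].
    by rewrite brMDl brMDr IH IH' opprD.
  rewrite !brM_pure // brN mulrC.
  by rewrite (additiveN (pureDl _)).
split; [exact: brMDl|exact: brMDr| |].
  move=> m; elim/pure_ind: m => [m1 m2 IH IH'|x z zS].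
    by rewrite brMDl !brMDr IH IH' (brMN m2) add0r addr0 subrr.
  case: brL => _ _ alt _; rewrite brM_pure // alt.
  exact: (additive0 (pureDl _)).
move=> m m' m''; elim/pure_ind: m => [m1 m2 IH IH'|x z zS].
  rewrite brMDl [brM m'' _]brMDr !brMDr brMDl brMDr.
  rewrite (addrACA (brM m1 _)) (addrACA (brM m1 _ + _)).
  by rewrite IH IH' addr0.
elim/pure_ind: m' => [m1 m2 IH IH'|y w wS].
  rewrite !(brMDl, brMDr) (addrACA (brM (pure x z) _)).
  by rewrite (addrACA (brM (pure x z) _ + _)) IH IH' addr0.
elim/pure_ind: m'' => [m1 m2 IH IH'|t u uS].
  rewrite !(brMDl, brMDr) (addrACA (brM (pure x z) _)).
  by rewrite (addrACA (brM (pure x z) _ + _)) IH IH' addr0.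
rewrite !brM_pure ?SM //.
have -> : w * (u * z) = z * (w * u) by ring.
have -> : u * (z * w) = z * (w * u) by ring.
rewrite -!pureDl; case: brL => _ _ _ ->.
exact: (additive0 (pureDl _)).
Qed.

Lemma gammaM_lie : lie_endo brM gammaM.
Proof.
split=> [|m m']; first exact: gammaMD.
elim/pure_ind: m => [m1 m2 IH IH'|x z zS].
  by rewrite !(brMDl, gammaMD) IH IH'.
elim/pure_ind: m' => [m1 m2 IH IH'|y w wS].
  by rewrite !(brMDr, gammaMD) IH IH'.
by rewrite !(brM_pure, gammaM_pure) //; case: gammaL => _ ->.
Qed.

Lemma gammaM_annihilates r : poly_annihilates r gamma ->
  poly_annihilates r gammaM.
Proof.
have Mz (m : M) k i : (m *~ k) i = m i *~ k.
  by apply: (additiveMz (f := fun m : M => m i)) => m1 m2; rewrite ffunE.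
have it i (m : M) k : iter i gammaM m k = iter i gamma (m k).
  by elim: i => //= i IHi; rewrite ffunE IHi.
move=> rg m; apply/ffunP=> k; rewrite sum_ffunE ffunE -[RHS](rg (m k)).
by apply: eq_bigr => i _; rewrite Mz it.
Qed.

Lemma mulrz_inj_ffun n : (forall u : L, u *~ n = 0 -> u = 0) ->
  forall m : M, m *~ n = 0 -> m = 0.
Proof.
move=> n_inj m /ffunP mn; apply/ffunP=> k; rewrite ffunE; apply: n_inj.
have := mn k; rewrite ffunE => <-.
by rewrite (additiveMz (f := fun m : M => m k)) // => m1 m2; rewrite ffunE.
Qed.

(* If [x] were nonzero, the order of [x] would divide all the coordinates of
   [1], making its inverse an algebraic integer. *)
Lemma pure1_inj x : {subset S <= Aint} -> pure x 1 = 0 -> x = 0.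
Proof.
move=> SA /ffunP px; pose u := cz 1.
have xcz k : x *~ u k = 0 by have := px k; rewrite !ffunE.
have [k0 k0P] : exists k, u k != 0.
  apply/existsP; apply: contraT; rewrite negb_exists => /forallP cz0.
  have := czP S1; rewrite big1 => [/eqP|k _]; first by rewrite oner_eq0.
  by have := cz0 k; rewrite negbK /u => /eqP->; rewrite mulr0z.
have ex_ord : exists c : nat, (0 < c)%N && (x *+ c == 0).
  exists (absz (u k0)); rewrite absz_gt0 k0P /=.
  case: (u k0) (xcz k0) => k; rewrite ?NegzE ?mulrNz -?pmulrn => /eqP //.
  by rewrite oppr_eq0.
case: (ex_minnP ex_ord) => c /andP[c_gt0 /eqP xc] c_min.
have c_dvd k : (c %| u k)%Z.
  have c_nz : (c : int) != 0 by rewrite eqz_nat -lt0n.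
  have xm : x *~ (u k %% c)%Z = 0.
    have := xcz k; rewrite {1}(divz_eq (u k) c) mulrzDr mulrC mulrzA.
    by rewrite -pmulrn xc mul0rz add0r.
  apply/dvdz_mod0P; move: xm (modz_ge0 (u k) c_nz) (ltz_mod (u k) c_nz).
  case: (modz (u k) c) => // -[//|i] xi _ ic.
  have {}ic : (i.+1 < c)%N by rewrite -ltz_nat.
  have := c_min i.+1; rewrite /= pmulrn xi eqxx => /(_ isT).
  by rewrite leqNgt ic.
pose y := \sum_i e i *~ (u i %/ c)%Z.
have yS : y \in S by apply: Ssum => i; apply: SMz.
have yc : y * c%:R = 1.
  rewrite [RHS](czP S1) mulr_suml; apply: eq_bigr => i _.
  by rewrite -[cz 1 i]/(u i) -[in RHS](divzK (c_dvd i)) mulrzA -pmulrn mulr_natr.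
have c_nz : c%:R != 0 :> algC by rewrite pnatr_eq0 -lt0n.
have yE : y = c%:R^-1 by rewrite -[LHS](mulfK c_nz) yc mul1r.
(* The element y = 1/c is rational and an algebraic integer, hence an integer. This forces c = 1, so
   x itself is 0. *)
have /intrP[w yw] : y \in Num.int.
  by rewrite Cint_rat_Aint ?SA // yE rpredV rpred_nat.
have : w * c%:Z = 1.
  by apply: (@intr_inj algC); rewrite rmorphM /= -yw.
move=> /eqP wc; have : (c %| 1)%N.
  by have := dvdz_mull w (dvdzz c%:Z); rewrite (eqP wc) dvdzE.
by rewrite dvdn1 => /eqP c1; rewrite -xc c1.
Qed.

End ScalarExtension.

(** * Rings of algebraic integers with a finite Z-basis *)

Section IntegerSpan.
Variable V : zmodType.

Definition int_span (n : nat) (y : 'I_n -> V) (z : V) :=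
  exists a : 'I_n -> int, z = \sum_i y i *~ a i.

Lemma int_span_gen n (y : 'I_n -> V) i : int_span y (y i).
Proof.
exists (fun k => Posz (i == k)); rewrite (bigD1 i) //= eqxx mulr1z.
by rewrite big1 ?addr0 // => k; rewrite eq_sym => /negPf->.
Qed.

Lemma int_span_trans n m (y : 'I_n -> V) (e : 'I_m -> V) z :
  (forall i, int_span e (y i)) -> int_span y z -> int_span e z.
Proof.
move=> ey [a ->]; elim/big_rec: _ => [|i x _ [c ->]].
  by exists (fun=> 0); rewrite big1 // => i _; rewrite mulr0z.
have [b ->] := ey i; exists (fun k => b k * a i + c k).
under [RHS]eq_bigr do rewrite mulrzDr mulrzA.
by rewrite big_split /= (additive_sum (mulrzDl (a i))).
Qed.

End IntegerSpan.

(* A nontrivial relation is, up to a unimodular change of generators, a multiple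
   of one generator, which therefore vanishes and can be dropped. *)
Lemma int_span_basis (F : numFieldType) n (y : 'I_n -> F) :
  exists N (e : 'I_N -> F),
  [/\ (forall i, int_span y (e i)), (forall i, int_span e (y i)) &
      (forall a b : 'I_N -> int,
         \sum_i e i *~ a i = \sum_i e i *~ b i -> a =1 b)].
Proof.
elim: n y => [|n IHn] y.
  by exists 0%N, y; split=> [||a b _]; case.
case: (classic (forall a b : 'I_n.+1 -> int,
         \sum_i y i *~ a i = \sum_i y i *~ b i -> a =1 b)) => [y_free|y_dep].
  by exists n.+1, y; split=> // i; apply: int_span_gen.
have [a [a_nz ya]] : exists a : 'rV[int]_n.+1,
    a != 0 /\ \sum_i y i *~ a 0 i = 0.
  apply: NNPP => no_rel; apply: y_dep => a b yab k.
  apply/eqP; apply: contraT => abk; case: no_rel.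
  exists (\row_i (a i - b i)); split.
    apply: contraNneq abk => /rowP/(_ k); rewrite !mxE => /eqP.
    by rewrite subr_eq0.
  under eq_bigr do rewrite mxE mulrzBr.
  by rewrite sumrB yab subrr.
have [A _ [R uR [d _ aE]]] := int_Smith_normal_form a.
have aR k : a 0 k = R ord0 k * (A ord0 ord0 * d`_0).
  rewrite aE mxE (bigD1 ord0) //= big1 => [|i i0].
    by rewrite addr0 mxE big_ord1 !mxE /= mulr1n mulrC.
  rewrite mxE big_ord1 !mxE /= eq_sym -val_eqE /= in i0 *.
  by rewrite (negPf i0) mulr0n mulr0 mul0r.
pose z i := \sum_k y k *~ R i k.
have z0 : z ord0 = 0.
  have c_nz : A ord0 ord0 * d`_0 != 0.
    apply: contraNneq a_nz => c0; apply/eqP/rowP=> k.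
    by rewrite aR c0 mulr0 mxE.
  have : z ord0 *~ (A ord0 ord0 * d`_0) = 0.
    rewrite /z (additive_sum (mulrzDl _)) -[RHS]ya.
    by apply: eq_bigr => k _; rewrite aR !mulrzA.
  by move/eqP; rewrite mulrz_eq0 (negPf c_nz) => /eqP.
have yz k : int_span z (y k).
  exists (fun i => invmx R k i); rewrite /z.
  under eq_bigr do rewrite (additive_sum (mulrzDl _)).
  rewrite exchange_big /= (bigD1 k) //= [X in _ + X]big1 ?addr0 => [|l lk].
    under eq_bigr do rewrite -mulrzA mulrC.
    rewrite -(big_morph _ (mulrzDr (y k)) (mulr0z _)).
    have /matrixP/(_ k k) := mulVmx uR; rewrite !mxE eqxx => ->.
    by rewrite mulr1z.
  under eq_bigr do rewrite -mulrzA mulrC.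
  rewrite -(big_morph _ (mulrzDr (y l)) (mulr0z _)).
  have /matrixP/(_ k l) := mulVmx uR; rewrite !mxE eq_sym (negPf lk) => ->.
  by rewrite mulr0z.
have [N [e [ye ey e_free]]] := IHn (fun i => z (lift ord0 i)).
exists N, e; split=> // i.
  apply: (int_span_trans _ (ye i)) => k.
  by exists (R (lift ord0 k)).
apply: (int_span_trans _ (yz i)) => k.
case: (unliftP ord0 k) => [l ->|->]; first exact: ey.
by rewrite z0; exists (fun=> 0); rewrite big1 // => l _; rewrite mulr0z.
Qed.

Lemma order_basis (X : seq algC) : {subset X <= Aint} ->
  exists (S : {pred algC}) (N : nat) (e : 'I_N -> algC)
         (cz : algC -> 'I_N -> int),
  [/\ subring_closed S, {subset X <= S}, {subset S <= Aint},
      (forall i, e i \in S) &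
      (forall z, z \in S -> z = \sum_i e i *~ cz z i) /\
      (forall a b : 'I_N -> int,
         \sum_i e i *~ a i = \sum_i e i *~ b i -> a =1 b)].
Proof.
move=> /Aint_subring_exists[S [ringS XS] [[n Y] _ /= SP]].
have [N [e [ye ey e_free]]] := int_span_basis (fun i : 'I_n => Y`_i).
(* [xchoose] turns existence into a coordinate function. It wants a boolean predicate on a choice
   type, hence finite functions, and a witness for every z, hence the implication, which 0 satisfies
   outside S. *)
have coordP z : exists a : {ffun 'I_N -> int},
    (z \in S) ==> (z == \sum_i e i *~ a i).
  case: (boolP (z \in S)) => [/SP[a zE]|_]; last by exists 0.
  have [|b ->] := int_span_trans (z := z) ey; first by exists a.
  exists (finfun b); apply/eqP; apply: eq_bigr => i _.
  by rewrite ffunE.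
exists S, N, e, (fun z => fun_of_fin (xchoose (coordP z))); split=> //.
- by apply: fin_Csubring_Aint SP; case: ringS => ? _ ?; split.
- by move=> i; apply/SP; have [a eE] := ye i; exists (finfun a);
     rewrite eE; apply: eq_bigr => k _; rewrite ffunE.
- split=> // z zS; have := xchooseP (coordP z).
  by move/implyP/(_ zS)/eqP.
Qed.

(* [c] is a unit of S[1/n]. *)
Definition unit_at (S : {pred algC}) (n : int) (c : algC) :=
  c \in S /\ exists w k, w \in S /\ c * w = n%:~R ^+ k.

(** * Generalized eigenspaces over S with n inverted *)

Section ScalarAction.
Variables (M : zmodType) (S : {pred algC}) (act : algC -> M -> M) (n : int).
Hypothesis ringS : subring_closed S.
Hypothesis actDr : forall c x y, act c (x + y) = act c x + act c y.
Hypothesis actDl : forall c d x, c \in S -> d \in S ->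
  act (c + d) x = act c x + act d x.
Hypothesis actM : forall c d x, c \in S -> d \in S ->
  act (c * d) x = act c (act d x).
Hypothesis act1 : forall x, act 1 x = x.
Hypothesis n_inj : forall x : M, x *~ n = 0 -> x = 0.
Hypothesis n_surj : forall x : M, exists y, y *~ n = x.

Let S1 := subring1 ringS.
Let SB := subringB ringS.
Let SM := subringM ringS.
Let S0 := subring0 ringS.
Let SN := subringN ringS.
Let SD := subringD ringS.

Lemma act0l x : act 0 x = 0.
Proof. by apply: (addrI (act 0 x)); rewrite -actDl // !addr0. Qed.

Lemma actNl c x : c \in S -> act (- c) x = - act c x.
Proof.
move=> cS; apply: (addrI (act c x)).
by rewrite -actDl ?SN // !subrr act0l.
Qed.

Lemma actBl c d x : c \in S -> d \in S -> act (c - d) x = act c x - act d x.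
Proof. by move=> cS dS; rewrite actDl ?SN // actNl. Qed.

Lemma act_int k x : act k%:~R x = x *~ k.
Proof.
have act_nat i : i%:R \in S /\ act i%:R x = x *+ i.
  elim: i => [|i [iS IHi]]; first by rewrite act0l.
  by rewrite mulrS SD // actDl // act1 IHi mulrS.
case: k => k; first by rewrite -!pmulrn; case: (act_nat k).
have [kS kE] := act_nat k.+1.
by rewrite NegzE !mulrNz -!pmulrn actNl // kE.
Qed.

(** Some multiple c w with w in S is a power of n, and n acts bijectively; this also gives
    [act_surj]. *)
Lemma act_inj c x : unit_at S n c -> act c x = 0 -> x = 0.
Proof.
case=> cS [w [k [wS cw]]] cx; apply: (mulrz_exp_inj (k := k) n_inj).
rewrite -act_int rmorphXn /= -cw mulrC actM // cx.
exact: (additive0 (actDr w)).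
Qed.

Lemma act_surj c x : unit_at S n c -> exists y, act c y = x.
Proof.
case=> cS [w [k [wS cw]]].
have [y <-] : exists y, y *~ n ^+ k = x.
  elim: k {cw} x => [|k IHk] x; first by exists x; rewrite expr0 mulr1z.
  have [y <-] := n_surj x; have [z <-] := IHk y.
  by exists z; rewrite exprSr mulrzA.
by exists (act w y); rewrite -actM // cw -rmorphXn act_int.
Qed.

Section GeneralizedEigenspaces.
Variable T : M -> M.
Hypothesis TD : forall x y, T (x + y) = T x + T y.
Hypothesis T_act : forall c x, c \in S -> T (act c x) = act c (T x).

Definition shift c x := T x - act c x.
Definition geig c x := exists k, iter k (shift c) x = 0.

Lemma shiftD c x y : shift c (x + y) = shift c x + shift c y.
Proof. by rewrite /shift TD actDr opprD addrACA. Qed.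

Lemma iter_shiftD c k x y :
  iter k (shift c) (x + y) = iter k (shift c) x + iter k (shift c) y.
Proof. by elim: k => //= k ->; rewrite shiftD. Qed.

Lemma iter_shift0 c k : iter k (shift c) 0 = 0.
Proof. exact: (additive0 (iter_shiftD c k)). Qed.

Lemma shift_act c d x : c \in S -> d \in S ->
  shift c (act d x) = act d (shift c x).
Proof.
move=> cS dS; rewrite /shift (additiveB (actDr d)) T_act //.
by rewrite -!actM // mulrC.
Qed.

Lemma shiftT c x : c \in S -> shift c (T x) = T (shift c x).
Proof. by move=> cS; rewrite /shift (additiveB TD) T_act. Qed.

Lemma shiftC c d x : c \in S -> d \in S ->
  shift c (shift d x) = shift d (shift c x).
Proof.
move=> cS dS; rewrite {2}/shift (additiveB (shiftD c)).
by rewrite shiftT // shift_act.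
Qed.

Lemma iter_comm (f g : M -> M) k x :
  (forall y, f (g y) = g (f y)) -> iter k f (g x) = g (iter k f x).
Proof. by move=> fg; elim: k => //= k ->. Qed.

Lemma iter_shift_le c k l x : (k <= l)%N ->
  iter k (shift c) x = 0 -> iter l (shift c) x = 0.
Proof. by move=> kl x0; rewrite -(subnK kl) iterD x0 iter_shift0. Qed.

Lemma geig0 c : geig c 0. Proof. by exists 0%N. Qed.

Lemma geigD c x y : geig c x -> geig c y -> geig c (x + y).
Proof.
move=> [k xk] [l yl]; exists (k + l)%N; rewrite iter_shiftD.
rewrite (iter_shift_le (leq_addr l k) xk) (iter_shift_le (leq_addl k l) yl).
exact: addr0.
Qed.

Lemma geigN c x : geig c x -> geig c (- x).
Proof.
by move=> [k xk]; exists k; rewrite (additiveN (iter_shiftD c k)) xk oppr0.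
Qed.

Lemma geigB c x y : geig c x -> geig c y -> geig c (x - y).
Proof. by move=> xc /geigN; apply: geigD. Qed.

Lemma geig_shift c d x : c \in S -> d \in S -> geig c x -> geig c (shift d x).
Proof.
move=> cS dS [k xk]; exists k; rewrite iter_comm ?xk //.
  exact: (additive0 (shiftD d)).
by move=> y; apply: shiftC.
Qed.

Lemma geig_iter_shift c d k x : c \in S -> d \in S -> geig c x ->
  geig c (iter k (shift d) x).
Proof. by move=> cS dS xc; elim: k => //= k; apply: geig_shift. Qed.

Lemma shiftE c d x : c \in S -> d \in S ->
  shift d x = shift c x + act (c - d) x.
Proof. by move=> cS dS; rewrite actBl // /shift addrA subrK. Qed.

(** By induction on the nilpotency exponent, (T - c) x = 0, since it satisfies the same hypotheses
    with a smaller exponent. Then (c - d) x = (T - d) x - (T - c) x = 0. *)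
Lemma geig_shift_inj c d x : c \in S -> d \in S -> unit_at S n (c - d) ->
  geig c x -> shift d x = 0 -> x = 0.
Proof.
move=> cS dS cd [k xk]; elim: k x xk => // k IHk x; rewrite iterSr => xk dx.
have cx : shift c x = 0.
  by apply: IHk => //; rewrite shiftC // dx (additive0 (shiftD c)).
by apply: (act_inj cd); have := shiftE x cS dS; rewrite dx cx add0r.
Qed.

(** T - d is the unit c - d plus the locally nilpotent T - c. Its inverse is built by successive
    correction: if (c - d) z = y, then (T - d) z exceeds y by (T - c) z, which has a smaller
    exponent and is hit by induction. *)
Lemma geig_shift_surj c d y : c \in S -> d \in S -> unit_at S n (c - d) ->
  geig c y -> exists2 z, geig c z & shift d z = y.
Proof.
move=> cS dS cd [k yk]; elim: k y yk => [y /= ->|k IHk y yk].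
  by exists 0; [apply: geig0|apply: (additive0 (shiftD d))].
have [z zy] := act_surj y cd.
have cdS : c - d \in S by apply: SB.
have zk : iter k.+1 (shift c) z = 0.
  apply: (act_inj cd); rewrite -iter_comm ?zy // => x.
  by rewrite shift_act.
have [|z' z'c z'z] := IHk (shift c z); first by rewrite -iterSr.
exists (z - z'); first by apply: geigB => //; exists k.+1.
by rewrite (additiveB (shiftD d)) z'z (shiftE z cS dS) zy addrC addKr.
Qed.

Lemma geig_disjoint c d x : c \in S -> d \in S -> unit_at S n (c - d) ->
  geig c x -> geig d x -> x = 0.
Proof.
move=> cS dS cd xc [k]; elim: k => //= k IHk xk; apply: IHk.
exact: geig_shift_inj (geig_iter_shift k cS dS xc) xk.
Qed.

(** This will kill the brackets whose would-be degree is not a root. *)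
Lemma geig_foldl_inj c (l : seq algC) x : c \in S ->
    (forall d, d \in l -> d \in S /\ unit_at S n (c - d)) ->
  geig c x -> foldl (fun v d => shift d v) x l = 0 -> x = 0.
Proof.
move=> cS; elim: l x => //= d l IHl x lP xc.
have [dS cd] := lP d (mem_head _ _).
move=> /IHl xl; apply: (geig_shift_inj cS dS cd xc); apply: xl.
  by move=> d' d'l; apply: lP; rewrite inE d'l orbT.
exact: geig_shift.
Qed.

Variables (U : seq algC) (phi : algC -> algC).
Hypothesis uniqU : uniq U.
Hypothesis phiS : forall t, t \in U -> phi t \in S.
Hypothesis phi_good : forall s t, s \in U -> t \in U -> s != t ->
  unit_at S n (phi s - phi t).

Definition geig_sum v := exists x : algC -> M,
  (forall t, t \in U -> geig (phi t) (x t)) /\ v = \sum_(t <- U) x t.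

Lemma geig_sum0 : geig_sum 0.
Proof. by exists (fun=> 0); split=> [t _|]; [apply: geig0|rewrite big1]. Qed.

Lemma geig_sumD v w : geig_sum v -> geig_sum w -> geig_sum (v + w).
Proof.
move=> [x [xP ->]] [y [yP ->]]; exists (fun t => x t + y t); split.
  by move=> t tU; apply: geigD; auto.
by rewrite big_split.
Qed.

Lemma geig_sum1 t v : t \in U -> geig (phi t) v -> geig_sum v.
Proof.
move=> tU vt; exists (fun s => if s == t then v else 0); split.
  by move=> s _; case: eqP => [->|_] //; apply: geig0.
rewrite (bigD1_seq t) //= eqxx big1 ?addr0 // => s /negPf-> //.
Qed.

(** Induction over the factors of an annihilating product, repetitions allowed; it replaces a Bezout
    identity between the factors. *)
Lemma geig_decomposition l v : {subset l <= U} ->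
  foldl (fun x t => shift (phi t) x) v l = 0 -> geig_sum v.
Proof.
elim: l v => [v _ /= ->|t l IHl v tlU /=]; first exact: geig_sum0.
have tU : t \in U by apply: tlU; rewrite mem_head.
move=> /IHl[|y [yP tv]].
  by move=> s sl; apply: tlU; rewrite inE sl orbT.
(* By induction (T - φ t) v is the sum of the y_s. The y_s with s ≠ t have preimages under T - φ t,
   whose sum is z. What remains lies in the eigenspace of t, and so does v - z, with exponent one
   larger. *)
have : exists2 z, geig_sum z &
    geig (phi t) (\sum_(s <- U) y s - shift (phi t) z).
  rewrite big_seq; elim/big_rec: _ => [|s x sU [z zU zt]].
    exists 0; first exact: geig_sum0.
    by rewrite (additive0 (shiftD _)) subr0; apply: geig0.
  have [st|st] := eqVneq s t.
    exists z => //; rewrite -addrA; apply: geigD => //.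
    by rewrite -st; apply: yP.
  have [z' z's z'y] := geig_shift_surj (phiS sU) (phiS tU)
    (phi_good sU tU st) (yP s sU).
  exists (z' + z); first by apply: geig_sumD => //; apply: geig_sum1 z's.
  by rewrite shiftD z'y opprD addrACA subrr add0r.
rewrite -tv => -[z zU]; rewrite -(additiveB (shiftD _)) => -[k zk].
rewrite -[v](subrK z) addrC; apply: geig_sumD => //.
by apply: (geig_sum1 tU); exists k.+1; rewrite iterSr.
Qed.

(** The index is the root t and not the eigenvalue φ t, so that degrees will multiply like roots.
    The disjunct x = 0 makes the component zero, rather than empty, at every t outside [U]. *)
Definition component t x := (t \in U /\ geig (phi t) x) \/ x = 0.

Lemma component_independent (s : seq algC) (x : algC -> M) : uniq s ->
    (forall t, t \in s -> component t (x t)) -> \sum_(t <- s) x t = 0 ->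
  forall t, t \in s -> x t = 0.
Proof.
elim: s x => // t s IHs x /= /andP[ts us] xP; rewrite big_cons => xs.
have sP u : u \in s -> component u (x u).
  by move=> us'; apply: xP; rewrite inE us' orbT.
suff xt0 : x t = 0.
  move=> u; rewrite inE => /predU1P[->//|]; apply: IHs => //.
  by move: xs; rewrite xt0 add0r.
case: (xP t (mem_head _ _)) => // -[tU [k xk]].
(* A power of T - φ t that kills x_t turns the relation into a shorter one, whose terms vanish by
   induction. Each other x_u then lies in two eigenspaces and is 0. *)
have xu0 u : u \in s -> iter k (shift (phi t)) (x u) = 0.
  apply: (IHs (fun u => iter k (shift (phi t)) (x u))) => // [w ws|].
    have [[wU xw]|->] := sP w ws; last by right; apply: iter_shift0.
    by left; split=> //; apply: geig_iter_shift; auto.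
  have := congr1 (iter k (shift (phi t))) xs.
  by rewrite iter_shiftD xk add0r (additive_sum (iter_shiftD _ k)) iter_shift0.
move: xs; rewrite big_seq big1 ?addr0 // => u us'.
have [[uU xu]|//] := sP u us'.
have ut : u != t by apply: contraNneq ts => <-.
apply: (geig_disjoint (phiS uU) (phiS tU) (phi_good uU tU ut) xu).
by exists k; apply: xu0.
Qed.

Lemma componentB t x y : component t x -> component t y -> component t (x - y).
Proof.
move=> [[tU xt]|->] [[tU' yt]|->].
- by left; split=> //; apply: geigB.
- by left; rewrite subr0.
- by left; split=> //; rewrite sub0r; apply: geigN.
- by right; rewrite subr0.
Qed.

End GeneralizedEigenspaces.

(** * Brackets of generalized eigenspaces *)

Section EigenspaceGrading.
Variables (br : M -> M -> M) (gamma : M -> M).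
Hypotheses (brL : is_lie_ring br) (gammaL : lie_endo br gamma).
Hypothesis gamma_act : forall c x, c \in S -> gamma (act c x) = act c (gamma x).
Hypothesis br_actl : forall c x y, c \in S -> br (act c x) y = act c (br x y).
Hypothesis br_actr : forall c x y, c \in S -> br x (act c y) = act c (br x y).

Variables (rs : seq algC) (a : int).
Let aC : algC := a%:~R.
Let T b x := gamma x *~ b.
Hypothesis aS : forall t, t \in rs -> aC * t \in S.
Hypothesis unit_at_a : unit_at S n aC.
Hypothesis unit_at_diff : forall s t, s \in rs -> t \in rs -> s != t ->
  unit_at S n (aC * s - aC * t).
Hypothesis unit_at_prod : forall s t u, s \in rs -> t \in rs -> u \in rs ->
  s * t \notin rs -> unit_at S n (aC * s * (aC * t) - aC * (aC * u)).
Hypothesis annih : forall v,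
  foldl (fun v t => shift (T a) (aC * t) v) v rs = 0.

Let brDl := lieDl brL.
Let brDr := lieDr brL.
Let br0l := lie0l brL.
Let br0r := lie0r brL.
Let brMzl := lieMzl brL.
Let brMzr := lieMzr brL.
Let TD b x y : T b (x + y) = T b x + T b y.
Proof. by rewrite /T; case: gammaL => -> _; rewrite mulrzDl. Qed.
Let T_act b c x : c \in S -> T b (act c x) = act c (T b x).
Proof. by move=> cS; rewrite /T gamma_act // (additiveMz (actDr c)). Qed.

(** Writing X = aγ - aλ and Y = aγ - aμ, one has (a^2 γ - (aλ)(aμ)) [x, y] = [X x, aγ y] +
    [aλ x, Y y]. Either i or j drops by one in each term, and multiplying by aλ or applying aγ does
    not raise the other exponent. *)
Let geig_br s t i j m x y : s \in rs -> t \in rs -> (i + j <= m)%N ->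
  iter i (shift (T a) (aC * s)) x = 0 -> iter j (shift (T a) (aC * t)) y = 0 ->
  iter m (shift (T (a * a)) (aC * s * (aC * t))) (br x y) = 0.
Proof.
move=> sR tR; elim: m i j x y => [|m IHm] [|i] [|j] x y //.
- by move=> _ /= -> _; rewrite br0l.
- by move=> _; rewrite -[iter 0 _ x]/x => -> _; rewrite br0l (iter_shift0 (TD _)).
- by move=> _; rewrite -[iter 0 _ x]/x => -> _; rewrite br0l (iter_shift0 (TD _)).
- by move=> _ _; rewrite -[iter 0 _ y]/y => ->; rewrite br0r (iter_shift0 (TD _)).
move=> ijm xi yj; rewrite iterSr.
have -> : shift (T (a * a)) (aC * s * (aC * t)) (br x y) =
    br (shift (T a) (aC * s) x) (T a y) +
    br (act (aC * s) x) (shift (T a) (aC * t) y).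
  rewrite /shift /T (additiveB (brDr _)) (additiveB (fun u v => brDl u v _)).
  rewrite brMzl !brMzr br_actl ?aS // br_actl ?aS // br_actr ?aS //.
  case: gammaL => _ ->.
  by rewrite addrA subrK -mulrzA actM ?aS.
rewrite !(addSn, addnS) ltnS in ijm.
rewrite (iter_shiftD (TD _)) (IHm i j.+1) ?addnS -?iterSr //; last first.
  rewrite (@iter_comm _ (T a)) ?yj ?(additive0 (TD a)) // => z.
  by rewrite shiftT ?aS //; apply: T_act.
rewrite (IHm i.+1 j) ?addr0 ?addSn -?iterSr //.
rewrite (@iter_comm _ (act (aC * s))) ?xi ?(additive0 (actDr _)) // => z.
by rewrite shift_act ?aS //; apply: T_act.
Qed.

Let shiftMz t x : aC * t \in S ->
  shift (T (a * a)) (aC * (aC * t)) x = shift (T a) (aC * t) x *~ a.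
Proof.
move=> tS; case: (unit_at_a) => aS' _.
by rewrite /shift /T actM // act_int mulrzBl -mulrzA.
Qed.

Let shiftMz_comm t x k : aC * t \in S ->
  shift (T a) (aC * t) (x *~ k) = shift (T a) (aC * t) x *~ k.
Proof. by move=> tS; apply: (additiveMz (shiftD (TD a) _)). Qed.

Let a_inj (x : M) k : x *~ a ^+ k = 0 -> x = 0.
Proof.
apply: mulrz_exp_inj => y ya; apply: (act_inj unit_at_a).
by rewrite /aC act_int.
Qed.

Lemma eigenspace_grading :
  is_grading br (component (T a) (undup rs) (fun t => aC * t)).
Proof.
have phiS t : t \in undup rs -> aC * t \in S by rewrite mem_undup => /aS.
have phi_good s t : s \in undup rs -> t \in undup rs -> s != t ->
    unit_at S n (aC * s - aC * t) by rewrite !mem_undup; apply: unit_at_diff.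
split.
- by move=> s; split=> [|x y]; [right|apply: componentB].
- move=> v; have [|x [xP ->]] := geig_decomposition (TD a) (@T_act a)
    (undup_uniq rs) phiS phi_good (l := rs) _ (annih v).
    by move=> t; rewrite mem_undup.
  exists (undup rs), x; split=> // t tU; left; split=> //; exact: xP.
- exact: (component_independent (TD a) (@T_act a) phiS phi_good).
move=> s t x y [[sU [i xi]]|->] [[tU [j yj]]|->];
  rewrite ?br0l ?br0r; try by right.
rewrite mem_undup in sU; rewrite mem_undup in tU.
have xy := geig_br sU tU (leqnn _) xi yj.
have [stR|stR] := boolP (s * t \in rs); [left|right].
  split; first by rewrite mem_undup.
  exists (i + j)%N; apply: (a_inj (k := (i + j)%N)).
  (* Here (as)(at) = a (a st), so the operator of [geig_br] is a times aγ - a st, and the resulting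
     power of a cancels. *)
  have stE : aC * s * (aC * t) = aC * (aC * (s * t)) by ring.
  rewrite stE in xy; rewrite -[RHS]xy; elim: (i + j)%N => [|k IHk].
    by rewrite expr0 mulr1z.
  by rewrite !iterS -IHk shiftMz ?aS // shiftMz_comm ?aS // exprSr mulrzA.
(* When st is not a root, the product of the a^2 γ - a (au) over the roots u is a power of a times
   the annihilating product, hence zero. Each factor is injective on the bracket's eigenspace
   because (as)(at) - a (au) is a unit. *)
pose rs2 := [seq aC * (aC * t) | t <- rs].
have stS : aC * s * (aC * t) \in S by rewrite SM ?aS.
apply: (geig_foldl_inj (TD (a * a)) (@T_act (a * a)) (l := rs2) stS).
- move=> _ /mapP[u uR ->]; case: unit_at_a => aS' _.
  by split; [rewrite SM ?aS|apply: unit_at_prod].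
- by exists (i + j)%N.
suff foldE l z : {subset l <= rs} ->
    foldl (fun v d => shift (T (a * a)) d v) z [seq aC * (aC * u) | u <- l] =
    foldl (fun v u => shift (T a) (aC * u) v) z l *~ a ^+ size l.
  by rewrite foldE // annih mul0rz.
elim: l z => [|u l IHl] z ulR /=; first by rewrite expr0 mulr1z.
have uS : aC * u \in S by apply/aS/ulR/mem_head.
rewrite IHl => [|w wl]; last by apply: ulR; rewrite inE wl orbT.
rewrite shiftMz // exprS mulrzA; congr (_ *~ _).
elim: l {IHl ulR} (shift _ _ z) => //= w l IHl y'.
by rewrite (additiveMz (shiftD (TD a) _)) IHl.
Qed.

End EigenspaceGrading.
End ScalarAction.

(** * Algebraic integers formed from roots of a non-monic polynomial *)

Lemma integral_Aint x : integralOver (intr : int -> algC) x <-> x \in Aint.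
Proof.
split=> [[p p_mon px]|xA].
  apply: root_monic_Aint px _ _; first exact: monic_map.
  by apply/polyOverP=> i; rewrite coef_map /= intr_int.
have /floorpP[p pE] : minCpoly x \is a polyOver Num.int by [].
exists p; last by rewrite -pE root_minCpoly.
have := minCpoly_monic x; rewrite pE !monicE.
by rewrite (lead_coef_map_inj (@intr_inj _)) //= (eqr_int _ _ 1).
Qed.

(** With b the leading coefficient and d the degree, b x is a root of the monic polynomial b^(d-1)
    p(X/b), whose lower coefficients form [q]. *)
Lemma lead_coef_root_Aint (p : {poly algC}) x :
  p \is a polyOver Aint -> root p x -> lead_coef p * x \in Aint.
Proof.
move=> pA px; have [->|p_nz] := eqVneq p 0; first by rewrite lead_coef0 mul0r.
set b := lead_coef p; set d := (size p).-1.
pose q := \poly_(i < d) (p`_i * b ^+ (d.-1 - i)).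
have sq : (size q < size ('X^d : {poly algC}))%N.
  by rewrite size_polyXn ltnS size_poly.
apply/integral_Aint; apply: (integral_root_monic (p := 'X^d + q)).
- by rewrite monicE lead_coefDl // lead_coefXn.
- have d_gt0 : (0 < d)%N.
    rewrite /d -subn1 subn_gt0 ltnNge; apply: contraL px => /size1_polyC pE.
    by rewrite pE rootC -polyC_eq0 -pE.
  rewrite rootE hornerD hornerXn horner_poly.
  have -> : (b * x) ^+ d + \sum_(i < d) p`_i * b ^+ (d.-1 - i) * (b * x) ^+ i
          = b ^+ d.-1 * p.[x].
    rewrite [p.[x]]horner_coef -[size p]prednK ?size_poly_gt0 //.
    rewrite big_ord_recr mulrDr /= addrC; congr (_ + _).
      rewrite mulr_sumr; apply: eq_bigr => i _.
      rewrite exprMn -[in RHS](@subnK i d.-1) ?exprD; first by ring.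
      by rewrite -ltnS prednK.
    rewrite -/d -[p`_d]/b exprMn mulrA -exprSr prednK //.
  by rewrite (rootP px) mulr0.
apply/integral_poly => i; apply/integral_Aint.
rewrite coefD coefXn coef_poly rpredD ?rpred_nat //.
by case: ifP => // _; rewrite rpredM ?rpredX ?(polyOverP pA) //.
Qed.

(** Although x may fail to be integral, b x is, where b is the leading coefficient of g and of g (X
    - x). Thus b X^k (X - x) has integral coefficients, and the leading term of g can be split
    off. *)
Lemma divXsubC_Aint (g : {poly algC}) x :
  g * ('X - x%:P) \is a polyOver Aint -> g \is a polyOver Aint.
Proof.
move: {2}_.+1 (ltnSn (size g)) => m; elim: m g => // m IHm g gm gA.
have [->|g_nz] := eqVneq g 0; first exact: rpred0.
pose b := lead_coef g; pose k := (size g).-1.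
have bA : b \in Aint.
  rewrite /b -[lead_coef g]mulr1 -(lead_coefXsubC x) -lead_coefM lead_coefE.
  exact: (polyOverP gA).
have bxA : b * x \in Aint.
  rewrite /b -[lead_coef g]mulr1 -(lead_coefXsubC x) -lead_coefM.
  by apply: lead_coef_root_Aint => //; rewrite rootM root_XsubC eqxx orbT.
have bX : b *: 'X^k \is a polyOver Aint.
  by apply/polyOverP=> i; rewrite coefZ coefXn rpredM ?rpred_nat.
rewrite -[g](subrK (b *: 'X^k)) rpredD //; apply: IHm.
  have sgk : size g = k.+1 by rewrite prednK // size_poly_gt0.
  rewrite ltnS in gm; apply: leq_trans gm; rewrite sgk ltnS.
  apply/leq_sizeP => i ki; rewrite coefB coefZ coefXn.
  move: ki; rewrite leq_eqVlt => /predU1P[<-|ki].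
    by rewrite eqxx mulr1 -[g`_k]/(lead_coef g) subrr.
  rewrite (gtn_eqF ki) mulr0 subr0 nth_default // sgk //.
rewrite mulrBl rpredB // mulrBr rpredB //.
  apply/polyOverP=> i; rewrite coefMX; case: ifP => // _.
  exact: (polyOverP bX).
rewrite mulrC mul_polyC scalerA; apply/polyOverP=> i.
by rewrite coefZ coefXn rpredM ?rpred_nat // mulrC.
Qed.

(** If g (X - x) is integral, then so is g, and therefore x g = g X - g (X - x). Each linear factor
    may thus be traded for its root or for 1. *)
Lemma scale_roots_Aint (q : {poly algC}) (s : seq algC) (Q : pred algC) :
  q * \prod_(x <- s) ('X - x%:P) \is a polyOver Aint ->
  (\prod_(x <- s | Q x) x) *: q \is a polyOver Aint.
Proof.
elim: s q => [|x s IHs] q; first by rewrite !big_nil mulr1 scale1r.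
rewrite !big_cons mulrA => /IHs; rewrite scalerAl => gA.
have := divXsubC_Aint gA; set g := _ *: q in gA * => gA'.
case: ifP => // _; rewrite -scalerA -/g.
have -> : x *: g = g * 'X - g * ('X - x%:P).
  by rewrite mulrBr opprB addrC subrK mulrC mul_polyC.
rewrite rpredB //; apply/polyOverP=> i; rewrite coefMX.
by case: ifP => // _; apply: (polyOverP gA').
Qed.

Section RootProducts.
Variables (p : {poly algC}) (U : seq algC).
Hypotheses (pA : p \is a polyOver Aint) (uniqU : uniq U).
Hypothesis rootU : all (root p) U.
Let a := lead_coef p.

(** Writing p = q ∏ (X - x), the number in question is the leading coefficient of the integral
    polynomial (∏ x) q. *)
Lemma root_subproduct_Aint (Q : pred algC) :
  a * \prod_(x <- U | Q x) x \in Aint.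
Proof.
have /dvdpP[q qE] : \prod_(x <- U) ('X - x%:P) %| p.
  by rewrite uniq_roots_dvdp // uniq_rootsE.
have aE : a = lead_coef q.
  rewrite /a qE lead_coefM (monicP (monic_prod_XsubC U xpredT id)).
  by rewrite mulr1.
have : (\prod_(x <- U | Q x) x) *: q \is a polyOver Aint.
  by apply: scale_roots_Aint; rewrite -qE.
move/polyOverP/(_ (size q).-1); rewrite coefZ mulrC.
by rewrite aE lead_coefE.
Qed.

(** A monomial with exponents at most K is a product of K square-free ones, each of which absorbs
    one factor a. *)
Lemma root_monomial_Aint (K : nat) (f : algC -> nat) :
  (forall x, x \in U -> (f x <= K)%N) ->
  a ^+ K * \prod_(x <- U) x ^+ f x \in Aint.
Proof.
elim: K f => [|K IHK] f fK.
  rewrite expr0 mul1r big_seq big1 // => x xU.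
  by have := fK x xU; rewrite leqn0 => /eqP->.
have -> : a ^+ K.+1 * \prod_(x <- U) x ^+ f x =
    (a * \prod_(x <- U | (0 < f x)%N) x) *
    (a ^+ K * \prod_(x <- U) x ^+ (f x).-1).
  rewrite exprS mulrACA; congr (_ * _).
  rewrite [X in X * _]big_mkcond -big_split; apply: eq_bigr => x _ /=.
  by case: (f x) => [|k]; rewrite /= ?mulr1 // exprS.
rewrite rpredM ?root_subproduct_Aint ?IHK // => x /fK.
by case: (f x).
Qed.

(** Expanding the product of differences gives monomials in which a root x occurs at most as often
    as it appears in the pairs of l; f records the exponents already picked up during the
    expansion. *)
Lemma root_differences_Aint (K : nat) (f : algC -> nat)
    (l : seq (algC * algC)) :
    {subset l <= [pred q | (q.1 \in U) && (q.2 \in U)]} ->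
    (forall x, x \in U ->
       f x + \sum_(q <- l) ((q.1 == x) + (q.2 == x)) <= K)%N ->
  a ^+ K * \prod_(x <- U) x ^+ f x * \prod_(q <- l) (q.1 - q.2) \in Aint.
Proof.
elim: l f => [|q l IHl] f qlU fK.
  rewrite big_nil mulr1; apply: root_monomial_Aint => x /fK.
  by rewrite big_nil addn0.
have /andP[q1U q2U] := qlU q (mem_head _ _).
have lU : {subset l <= [pred q | (q.1 \in U) && (q.2 \in U)]}.
  by move=> q' q'l; apply: qlU; rewrite inE q'l orbT.
have incr z : z \in U -> z * \prod_(x <- U) x ^+ f x =
    \prod_(x <- U) x ^+ (f x + (z == x)).
  move=> zU; under [RHS]eq_bigr do rewrite exprD.
  rewrite big_split /= mulrC; congr (_ * _).
  rewrite (bigD1_seq z) //= eqxx expr1 big1 ?mulr1 // => x.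
  by rewrite eq_sym => /negPf->; rewrite expr0.
rewrite big_cons.
have -> : forall u v w : algC, u * v * ((q.1 - q.2) * w) =
    u * (q.1 * v) * w - u * (q.2 * v) * w by move=> u v w; ring.
rewrite !incr // rpredB //; apply: IHl => // x /fK; rewrite big_cons.
  by apply: leq_trans; rewrite -!addnA leq_add2l leq_add2l leq_addl.
by apply: leq_trans; rewrite -addnA leq_add2l -addnA leq_addl.
Qed.

Lemma discriminant_Aint :
  a ^+ (2 * size U) * \prod_(x <- U) \prod_(y <- U | x != y) (x - y) \in Aint.
Proof.
pose l := [seq q <- [seq (x, y) | x <- U, y <- U] | q.1 != q.2].
have -> : \prod_(x <- U) \prod_(y <- U | x != y) (x - y) =
    \prod_(x <- U) x ^+ 0%N * \prod_(q <- l) (q.1 - q.2).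
  rewrite [X in _ = X * _]big1 ?mul1r => [|x _]; last by rewrite expr0.
  rewrite /l big_filter [RHS]big_mkcond big_allpairs; apply: eq_bigr => x _.
  by rewrite [LHS]big_mkcond; apply: eq_bigr.
rewrite mulrA; apply: (root_differences_Aint (f := fun=> 0%N)).
  move=> q; rewrite mem_filter => /andP[_ /allpairsP[[x y] [? ? ->]]].
  exact/andP.
(* A root occurs at most |U| times as first entry of a pair and |U| times as second, which explains
   the exponent 2 |U|. *)
move=> x xU; rewrite add0n /l big_filter.
apply: (@leq_trans (\sum_(q <- [seq (x, y) | x <- U, y <- U])
                      ((q.1 == x) + (q.2 == x)))).
  by rewrite big_mkcond /=; apply: leq_sum => q _; case: ifP.
rewrite big_allpairs /=.
have sum_eq : (\sum_(y <- U) (y == x) = 1)%N.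
  rewrite -[RHS](_ : count_mem x U = 1%N); last by rewrite count_uniq_mem // xU.
  by rewrite -sum1_count [RHS]big_mkcond; apply: eq_bigr => y _ /=; case: eqP.
under eq_bigr do rewrite big_split /= sum_eq.
rewrite big_split /= sum1_size exchange_big /=.
under eq_bigr do rewrite sum_eq.
by rewrite sum1_size addnn mul2n.
Qed.

End RootProducts.

(** * Evaluating polynomials over S at γ *)

Section FunctionalCalculus.
Variables (M : zmodType) (S : {pred algC}) (act : algC -> M -> M).
Hypothesis ringS : subring_closed S.
Hypothesis actDr : forall c x y, act c (x + y) = act c x + act c y.
Hypothesis actDl : forall c d x, c \in S -> d \in S ->
  act (c + d) x = act c x + act d x.
Hypothesis actM : forall c d x, c \in S -> d \in S ->
  act (c * d) x = act c (act d x).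
Hypothesis act1 : forall x, act 1 x = x.
Variable gamma : M -> M.
Hypothesis gammaD : forall x y, gamma (x + y) = gamma x + gamma y.
Hypothesis gamma_act : forall c x, c \in S -> gamma (act c x) = act c (gamma x).
Variable a : int.
Let aC : algC := a%:~R.
Let T x := gamma x *~ a.

Let SB := subringB ringS.
Let SM := subringM ringS.
Let S1 := subring1 ringS.
Let S0 := subring0 ringS.

Let actBl := actBl ringS actDl.
Let act_int := act_int ringS actDl act1.

(** The number m of terms is separate from [size p], so that a linear factor raises it by exactly
    one, whatever the size of the product. *)
Definition poly_act m (p : {poly algC}) v :=
  \sum_(i < m) act p`_i (iter i gamma v).

Hypothesis aS : aC \in S.

Let iter_gammaD i x y :
  iter i gamma (x + y) = iter i gamma x + iter i gamma y.
Proof. by elim: i => //= i ->. Qed.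

Let lin c : {poly algC} := aC *: 'X - c%:P.

Let coef_lin (p : {poly algC}) c i :
  (p * lin c)`_i = aC * (if i == 0%N then 0 else p`_i.-1) - p`_i * c.
Proof. by rewrite mulrBr coefB coefMC -scalerAr coefZ coefMX. Qed.

Lemma poly_act_mul m (p : {poly algC}) c v : c \in S ->
    (forall i, p`_i \in S) -> (size p <= m)%N ->
  poly_act m.+1 (p * lin c) v = poly_act m p (shift act T c v).
Proof.
move=> cS pS sp; rewrite /poly_act.
under eq_bigr => i _.
  rewrite coef_lin actBl; [over|by case: ifP => _; rewrite SM|by rewrite SM].
(* The X part has no term of index 0, and the constant part none of index m because p has size at
   most m; the remaining terms match after a shift. *)
rewrite sumrB big_ord_recl big_ord_recr /=.
rewrite [p`_m]nth_default // mul0r mulr0 !(act0l ringS actDl) add0r addr0.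
rewrite -sumrB; apply: eq_bigr => i _.
rewrite /shift (additiveB (iter_gammaD i)) (additiveB (actDr _)).
congr (_ - _).
  rewrite /T (additiveMz (iter_gammaD i)) -iterSr /=.
  by rewrite mulrC actM // act_int.
rewrite actM //; congr (act _ _).
by elim: (nat_of_ord i) => //= k <-; rewrite gamma_act.
Qed.

Lemma poly_act_foldl m (p : {poly algC}) (l : seq algC) v :
    (forall i, p`_i \in S) -> (size p <= m)%N ->
    (forall t, t \in l -> aC * t \in S) ->
  poly_act (m + size l) (p * \prod_(t <- l) lin (aC * t)) v =
  poly_act m p (foldl (fun v t => shift act T (aC * t) v) v l).
Proof.
move=> pS sp.
have coefsS l' : (forall t, t \in l' -> aC * t \in S) ->
    (forall i, (p * \prod_(t <- l') lin (aC * t))`_i \in S) /\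
    (size (p * \prod_(t <- l') lin (aC * t))%R <= m + size l')%N.
  elim: l' => [|t l' IHl] lS; first by rewrite big_nil mulr1 addn0.
  have [|qS sq] := IHl; first by move=> u ul; apply: lS; rewrite inE ul orbT.
  rewrite big_cons [lin _ * _]mulrC mulrA; set q := p * _ in qS sq *; split.
    move=> i; rewrite coef_lin SB // SM ?lS ?mem_head //.
    by case: ifP.
  apply: leq_trans (size_polyMleq _ _) _.
  have : (size (lin (aC * t)) <= 2)%N.
    apply: leq_trans (size_polyD _ _) _; rewrite geq_max size_polyN size_polyC.
    rewrite (leq_trans (size_scale_leq _ _)) ?size_polyX //.
    by case: (_ != 0).
  move=> s2; rewrite -subn1 leq_subLR /= addnS add1n -addn2.
  by rewrite leq_add.
elim: l v => [|t l IHl] v lS; first by rewrite big_nil mulr1 addn0.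
have lS' u : u \in l -> aC * u \in S.
  by move=> ul; apply: lS; rewrite inE ul orbT.
have [qS sq] := coefsS l lS'.
rewrite big_cons [lin _ * _]mulrC mulrA /= addnS poly_act_mul ?lS ?mem_head //.
by rewrite IHl.
Qed.

Lemma annihilates_foldl (r : {poly int}) (rs : seq algC) :
    rC r = aC *: \prod_(t <- rs) ('X - t%:P) -> a != 0 -> (0 < size rs)%N ->
    (forall t, t \in rs -> aC * t \in S) -> poly_annihilates r gamma ->
  forall v, foldl (fun v t => shift act T (aC * t) v) v rs = 0.
Proof.
move=> rE a_nz rs_gt0 rsS rg v.
have aC_nz : aC != 0 by rewrite intr_eq0.
have <- : poly_act (1 + size rs) (1 * \prod_(t <- rs) lin (aC * t)) v =
    foldl (fun v t => shift act T (aC * t) v) v rs.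
  rewrite poly_act_foldl ?size_poly1 //; last first.
    by move=> i; rewrite coef1; case: (i == 0%N).
  by rewrite /poly_act big_ord1 coef1 act1.
have sr : size r = (1 + size rs)%N.
  rewrite -(size_map_inj_poly (f := intr : int -> algC)) //; last exact: intr_inj.
  by rewrite -[map_poly _ _]/(rC r) rE size_scale // size_prod_XsubC.
(* The product of the aX - aλ carries a^d, of which r already contains one factor a. *)
have <- : (aC ^+ (size rs).-1) *: rC r = 1 * \prod_(t <- rs) lin (aC * t).
  rewrite mul1r rE scalerA -exprSr prednK //.
  have -> : \prod_(t <- rs) lin (aC * t) = \prod_(t <- rs) (aC *: ('X - t%:P)).
    by apply: eq_bigr => t _; rewrite scalerBr -[aC *: t%:P]mul_polyC -polyCM.
  elim: rs {rE rs_gt0 rsS sr} => [|t l IHl].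
    by rewrite !big_nil expr0 scale1r.
  by rewrite !big_cons -IHl -scalerAl -scalerAr scalerA exprS.
rewrite /poly_act -sr -[RHS](mul0rz _ (a ^+ (size rs).-1)) -[in RHS](rg v).
rewrite (additive_sum (mulrzDl _)); apply: eq_bigr => i _.
by rewrite coefZ coef_map /aC -rmorphXn -rmorphM /= act_int mulrC mulrzA.
Qed.

End FunctionalCalculus.

(** * Units of S[1/n] *)

Section UnitsAt.
Variables (S : {pred algC}) (n : int).
Hypothesis ringS : subring_closed S.

Let SM := subringM ringS.
Let S1 := subring1 ringS.

Lemma unit_at1 : unit_at S n 1.
Proof. by split=> //; exists 1, 0%N; rewrite mul1r. Qed.

Lemma unit_atM c d : unit_at S n c -> unit_at S n d -> unit_at S n (c * d).
Proof.
case=> cS [w [k [wS cw]]] [dS [v [l [vS dv]]]]; split; first exact: SM.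
by exists (w * v), (k + l)%N; rewrite mulrACA cw dv exprD SM.
Qed.

Lemma unit_at_factor c w :
  c \in S -> w \in S -> unit_at S n (c * w) -> unit_at S n c.
Proof.
move=> cS wS [_ [v [k [vS cv]]]]; split=> //.
by exists (w * v), k; rewrite mulrA SM.
Qed.

Lemma unit_at_bigprod (I : Type) (s : seq I) (Q : pred I) (F : I -> algC) :
  (forall i, Q i -> unit_at S n (F i)) -> unit_at S n (\prod_(i <- s | Q i) F i).
Proof.
move=> FP; elim/big_rec: _ => [|i c Qi]; first exact: unit_at1.
by apply: unit_atM; auto.
Qed.

Lemma unit_atX c k : unit_at S n c -> unit_at S n (c ^+ k).
Proof.
move=> cP; elim: k => [|k IHk]; first exact: unit_at1.
by rewrite exprS; apply: unit_atM.
Qed.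

Lemma unit_at_bigprod_factor (I : eqType) (s : seq I) (Q : pred I)
    (F : I -> algC) :
    (forall i, i \in s -> F i \in S) -> unit_at S n (\prod_(i <- s | Q i) F i) ->
  forall i, i \in s -> Q i -> unit_at S n (F i).
Proof.
elim: s => // j s IHs FS sP i; rewrite inE => ij Qi.
have FS' k : k \in s -> F k \in S by move=> ks; apply: FS; rewrite inE ks orbT.
have sS := subring_prod ringS Q FS'.
have jS := FS j (mem_head _ _).
move: sP; rewrite big_cons; case: ifP => Qj sP.
  case/predU1P: ij => [->|ins]; first exact: unit_at_factor sP.
  by apply: IHs => //; rewrite mulrC in sP; apply: unit_at_factor sP.
case/predU1P: ij => [ij|ins]; first by rewrite ij Qj in Qi.
exact: IHs.
Qed.

End UnitsAt.

(** * Divisibility properties of Discr_* and Prod_* *)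

Section Roots.
Variable r : {poly int}.
Hypothesis r_nc : ~~ is_constant r.
Let a := lead_coef r.
Let aC : algC := a%:~R.
Let rs := roots_mult r.

Let r_nz : r != 0.
Proof. by apply: contraNneq r_nc => ->; rewrite /is_constant size_poly0. Qed.

Lemma lead_coef_neq0 : a != 0. Proof. by rewrite lead_coef_eq0. Qed.
Let aC_nz : aC != 0. Proof. by rewrite intr_eq0 lead_coef_neq0. Qed.

Let lead_rC : lead_coef (rC r) = aC.
Proof. by rewrite (lead_coef_map_inj (@intr_inj _)). Qed.

Lemma rC_factor : rC r = aC *: \prod_(t <- rs) ('X - t%:P).
Proof.
by rewrite -lead_rC /rs /roots_mult; case: closed_field_poly_normal.
Qed.

Lemma root_rC t : root (rC r) t = (t \in rs).
Proof. by rewrite rC_factor rootZ // root_prod_XsubC. Qed.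

Lemma size_roots : (size rs).+1 = size r.
Proof.
rewrite -(size_map_inj_poly (f := intr : int -> algC)) //; last exact: intr_inj.
by rewrite -[map_poly _ _]/(rC r) rC_factor size_scale // size_prod_XsubC.
Qed.

Let d := (size r).-1.
Let size_rs : size rs = d. Proof. by rewrite /d -size_roots. Qed.

Lemma size_roots_gt0 : (0 < size rs)%N.
Proof. by rewrite -ltnS size_roots ltnNge. Qed.

Let droots_mem t : (t \in droots r) = (t \in rs).
Proof. by rewrite mem_undup. Qed.

Let rC_Aint : rC r \is a polyOver Aint.
Proof. by apply/polyOverP=> i; rewrite coef_map /= Aint_int. Qed.

Lemma scaled_root_Aint t : t \in rs -> aC * t \in Aint.
Proof.
by rewrite -root_rC -lead_rC => /lead_coef_root_Aint; apply.
Qed.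

Lemma maxmult_le : (maxmult r <= d)%N.
Proof.
rewrite /maxmult; elim/big_ind: _ => // [x y xd yd|t _].
  by rewrite geq_max xd.
by rewrite -size_rs count_size.
Qed.

Lemma maxmult_gt0 : (0 < maxmult r)%N.
Proof.
have := size_roots_gt0; case rsE : rs => [//|t l] _.
have tU : t \in droots r by rewrite droots_mem rsE mem_head.
rewrite /maxmult; apply: (leq_trans _ (leq_bigmax_seq _ tU isT)).
by rewrite -has_count has_pred1 -/rs rsE mem_head.
Qed.

Let discr_starE : discr_star r = aC ^+ (1 + 2 * d ^ 2) *
  ((maxmult r).-1)`!%:R *
  (\prod_(x <- droots r) \prod_(y <- droots r | x != y) (x - y)) ^+ maxmult r.
Proof.
rewrite /discr_star (negPf r_nc) -/a -/aC -/d; congr (_ * _).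
rewrite -prodrXl; apply: eq_bigr => x _.
by rewrite -prodrXl.
Qed.

(** D / a is rational, so it is an integer as soon as it is an algebraic integer. *)
Lemma lead_coef_dvd_discr (D : int) :
  D%:~R = discr_star r -> exists t : int, D = a * t.
Proof.
move=> DE; set Pi := \prod_(x <- droots r) \prod_(y <- droots r | x != y) (x - y).
have DaA : D%:~R / aC \in Aint.
  have PiA : aC ^+ (2 * d) * Pi \in Aint.
    have UA : aC ^+ (2 * size (droots r)) * Pi \in Aint.
      rewrite -lead_rC; apply: discriminant_Aint => //.
        exact: undup_uniq.
      by apply/allP=> t; rewrite droots_mem -root_rC.
    have Ud : (2 * size (droots r) <= 2 * d)%N.
      by rewrite leq_mul2l /= -size_rs size_undup.
    rewrite -(subnKC Ud) exprD mulrAC rpredM // rpredX //.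
    exact: Aint_int.
  rewrite DE discr_starE -/Pi.
  (* As m ≤ d, the exponent 2d^2 splits into 2dm, which makes the m-th power of the difference
     product integral, and a nonnegative rest; the extra 1 pays for the division by a. *)
  have -> : (1 + 2 * d ^ 2 = 1 + 2 * d * (d - maxmult r) + 2 * d * maxmult r)%N.
    by rewrite -addnA -mulnDr subnK ?maxmult_le // -mulnA.
  rewrite !exprD expr1 [aC ^+ (2 * d * maxmult r)]exprM.
  set u := aC ^+ (_ * _); set m := maxmult r; set f := _`!%:R.
  have -> : aC * u * (aC ^+ (2 * d)) ^+ m * f * Pi ^+ m / aC =
      u * f * (aC ^+ (2 * d) * Pi) ^+ m.
    by rewrite exprMn; field.
  have uA : u \in Aint by rewrite rpredX // Aint_int.
  by apply: rpredM; [apply: rpredM => //; apply: rpred_nat|apply: rpredX].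
have /intrP[t tE] : D%:~R / aC \in Num.int.
  by rewrite Cint_rat_Aint // rpred_div ?rpred_int.
exists t; apply: (@intr_inj algC); rewrite rmorphM /= -tE.
by rewrite mulrC divfK.
Qed.

Variables (S : {pred algC}) (D P : int).
Hypothesis ringS : subring_closed S.
Hypothesis rsS : forall t, t \in rs -> aC * t \in S.
Hypothesis DE : D%:~R = discr_star r.
Hypothesis PE : P%:~R = prod_star r.

Let SB := subringB ringS.
Let SM := subringM ringS.
Let SZ := subring_int ringS.
Let aS : aC \in S. Proof. exact: SZ. Qed.

Let unit_at_D : unit_at S (D * P) D%:~R.
Proof.
by split=> //; exists P%:~R, 1%N; rewrite SZ expr1 rmorphM.
Qed.

Let unit_at_P : unit_at S (D * P) P%:~R.
Proof.
by split=> //; exists D%:~R, 1%N; rewrite SZ expr1 rmorphM mulrC.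
Qed.

Lemma unit_at_lead_coef : unit_at S (D * P) aC.
Proof.
have [t tE] := lead_coef_dvd_discr DE.
apply: (unit_at_factor ringS (w := t%:~R)) => //.
by rewrite -rmorphM /= -tE.
Qed.

(** Let B be the product of all aλ - aμ with λ ≠ μ. Then B^m a^(1+2d^2) (m-1)! equals D times a
    power of a, hence is a unit; B divides it in S, and so does each factor of B. *)
Lemma unit_at_root_diff s t : s \in rs -> t \in rs -> s != t ->
  unit_at S (D * P) (aC * s - aC * t).
Proof.
move=> sR tR st.
have FS x y : x \in droots r -> y \in droots r -> aC * x - aC * y \in S.
  by rewrite !droots_mem => xR yR; rewrite SB ?rsS.
pose B := \prod_(x <- droots r) \prod_(y <- droots r | x != y) (aC * x - aC * y).
have BS : B \in S.
  apply: subring_prod => // x xU; apply: subring_prod => // y.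
  exact: FS.
suff : unit_at S (D * P) B.
  move/unit_at_bigprod_factor => /(_ ringS) h.
  have := h _ s; rewrite droots_mem => /(_ _ sR isT).
  move/(_ (fun x xU => subring_prod ringS _ (fun y => FS x y xU))).
  move/unit_at_bigprod_factor => /(_ ringS (fun y => FS s y _)).
  by apply; rewrite ?droots_mem.
apply: (unit_at_factor ringS (w := B ^+ (maxmult r).-1)) => //.
  exact: subringX.
rewrite -exprS prednK ?maxmult_gt0 //.
pose A := \prod_(x <- droots r) \prod_(y <- droots r | x != y) aC.
have BE : B = A * \prod_(x <- droots r) \prod_(y <- droots r | x != y) (x - y).
  rewrite -big_split; apply: eq_bigr => x _ /=.
  by rewrite -big_split; apply: eq_bigr => y _ /=; rewrite mulrBr.
apply: (unit_at_factor ringS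
  (w := aC ^+ (1 + 2 * d ^ 2) * ((maxmult r).-1)`!%:R)).
- exact: subringX.
- by rewrite SM ?(subringX _ _ aS) // pmulrn.
rewrite BE exprMn mulrAC -mulrA -discr_starE -DE.
apply: unit_atM => //; apply: unit_atX => //.
apply: unit_at_bigprod => // x _; apply: unit_at_bigprod => // y _.
exact: unit_at_lead_coef.
Qed.

(** The product over all roots z of (ax)(ay) - a(az), times a, is a^(2d) r(xy). Multiplied over the
    pairs with r(xy) ≠ 0 and by a^(2d^3), this gives P times a power of a, which is a unit, so all
    the factors are units. *)
Lemma unit_at_root_prod s t u : s \in rs -> t \in rs -> u \in rs ->
  s * t \notin rs -> unit_at S (D * P) (aC * s * (aC * t) - aC * (aC * u)).
Proof.
move=> sR tR uR stR.
pose C x y := \prod_(z <- rs) (aC * x * (aC * y) - aC * (aC * z)).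
have CS x y : x \in droots r -> y \in droots r -> aC * C x y \in S.
  rewrite !droots_mem => xR yR; rewrite SM //; apply: subring_prod => // z zR.
  by apply: SB; apply: SM; rewrite ?rsS.
pose B := \prod_(x <- droots r)
  \prod_(y <- droots r | (rC r).[x * y] != 0) (aC * C x y).
have BS : B \in S.
  by apply: subring_prod => // x xU; apply: subring_prod => // y; apply: CS.
pose A := \prod_(z <- rs) (aC * aC).
have CE x y : aC * C x y = A * (rC r).[x * y].
  rewrite rC_factor hornerZ horner_prod mulrCA; congr (_ * _).
  rewrite -big_split; apply: eq_bigr => z _ /=; rewrite hornerXsubC; ring.
have gA : unit_at S (D * P) A.
  apply: unit_at_bigprod => // z _.
  by apply: unit_atM => //; apply: unit_at_lead_coef.
have gB : unit_at S (D * P) B.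
  apply: (unit_at_factor ringS (w := aC ^+ (2 * d ^ 3))) => //.
    exact: subringX.
  pose A2 := \prod_(x <- droots r)
    \prod_(y <- droots r | (rC r).[x * y] != 0) A.
  have -> : B * aC ^+ (2 * d ^ 3) = A2 * P%:~R.
    rewrite PE /prod_star (negPf r_nc) -/a -/aC -/d mulrC mulrCA; congr (_ * _).
    rewrite -big_split; apply: eq_bigr => x _ /=.
    by rewrite -big_split; apply: eq_bigr => y _ /=.
  apply: unit_atM => //; apply: unit_at_bigprod => // x _.
  by apply: unit_at_bigprod.
have sU : s \in droots r by rewrite droots_mem.
have tU : t \in droots r by rewrite droots_mem.
have gs := unit_at_bigprod_factor ringS
  (fun x xU => subring_prod ringS _ (fun y => CS x y xU)) gB sU isT.
have st_nz : (rC r).[s * t] != 0 by rewrite -[_ == 0]/(root _ _) root_rC.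
have := unit_at_bigprod_factor ringS (fun y => CS s y sU) gs tU st_nz.
rewrite [aC * _]mulrC => /(unit_at_factor ringS) gC.
have facS z : z \in rs -> aC * s * (aC * t) - aC * (aC * z) \in S.
  by move=> zR; apply: SB; apply: SM; rewrite ?rsS.
have gst : unit_at S (D * P) (C s t) by apply: gC => //; apply: subring_prod.
exact: (unit_at_bigprod_factor ringS facS gst uR isT).
Qed.

End Roots.

(** * Construction of the embedding *)

(** A constant r equals Discr_*(r) and annihilates [L], so every element of [L] is killed by D P and
    [L] is zero. *)
Lemma graded_embedding_const (L : zmodType) (br : L -> L -> L) (gamma : L -> L)
    (r : {poly int}) (D P : int) :
  is_constant r -> is_lie_ring br -> poly_annihilates r gamma ->
  D%:~R = discr_star r -> ~ has_torsion L (D * P) ->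
  exists (K : zmodType) (brK : K -> K -> K) (Ks : algC -> K -> Prop)
         (f : L -> K),
    [/\ is_lie_ring brK, is_grading brK Ks,
        (forall s, in_support Ks s -> root (rC r) s) &
     [/\ (forall x y, f (x + y) = f x + f y),
         (forall x y, f (br x y) = brK (f x) (f y)) & injective f]].
Proof.
move=> r_const brL rg; rewrite /discr_star r_const => /intr_inj DE no_tors.
have L0 (x : L) : x = 0.
  apply/eqP; apply: contraT => x_nz; case: no_tors; exists x; split=> //.
  rewrite mulrzA DE (_ : x *~ r`_0 = 0) ?mul0rz //.
  have := rg x; move: r_const; rewrite /is_constant.
  case E : (size r) => [|[|m]] // _; last by rewrite big_ord1.
  by move: E => /eqP; rewrite size_poly_eq0 => /eqP->; rewrite coef0 mulr0z.
exists L, br, (fun _ x => x = 0), id; split=> //; first split.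
- by move=> s; split=> // x y -> ->; rewrite subr0.
- by move=> v; exists [::], (fun=> 0); rewrite big_nil.
- by move=> s x _ xP _ t /xP.
- by [].
- by move=> s [x [->]]; rewrite eqxx.
- by split.
Qed.

Lemma graded_embedding (L : zmodType) (br : L -> L -> L) (gamma : L -> L)
    (r : {poly int}) (D P : int) :
  ~~ is_constant r ->
  is_lie_ring br -> lie_endo br gamma -> poly_annihilates r gamma ->
  D%:~R = discr_star r -> P%:~R = prod_star r ->
  ~ has_torsion L (D * P) ->
  exists (K : zmodType) (brK : K -> K -> K) (Ks : algC -> K -> Prop)
         (f : L -> K),
    [/\ is_lie_ring brK, is_grading brK Ks,
        (forall s, in_support Ks s -> root (rC r) s) &
     [/\ (forall x y, f (x + y) = f x + f y),
         (forall x y, f (br x y) = brK (f x) (f y)) & injective f]].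
Proof.
move=> r_nc brL gL rg DE PE no_tors.
have n_inj (x : L) : x *~ (D * P) = 0 -> x = 0.
  by move=> xn; apply/eqP; apply: contraT => x_nz; case: no_tors; exists x.
have [L1 [br1 [g1 [j [brL1 gL1 rg1 [n_inj1 n_surj1] [jD jbr j_inj]]]]]] :=
  lie_localization brL gL n_inj rg.
set a : algC := (lead_coef r)%:~R.
have [|S [N [e [cz [ringS XS SA eS [czP e_free]]]]]] :=
  order_basis (X := [seq a * t | t <- roots_mult r]).
  by move=> _ /mapP[t tR ->]; apply: scaled_root_Aint.
have rsS t : t \in roots_mult r -> a * t \in S.
  by move=> tR; apply/XS/map_f.
pose M := {ffun 'I_N -> L1}.
have n_injM (m : M) : m *~ (D * P) = 0 -> m = 0 by apply: mulrz_inj_ffun.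
have n_surjM (m : M) : exists m', m' *~ (D * P) = m.
  elim/(pure_ind ringS eS czP e_free): m => [m m' [w <-] [w' <-]|x z zS].
    by exists (w + w'); rewrite mulrzDl.
  have [y <-] := n_surj1 x; exists (pure cz y z).
  by rewrite (additiveMz (pureDl cz z)).
pose act : algC -> M -> M := @scal N e cz L1.
have actDr c x y : act c (x + y) = act c x + act c y by apply: scalDr.
have actDl c d x : c \in S -> d \in S -> act (c + d) x = act c x + act d x.
  exact: (scalDl ringS eS czP e_free).
have actM c d x : c \in S -> d \in S -> act (c * d) x = act c (act d x).
  exact: (scalM ringS eS czP e_free).
have act1 x : act 1 x = x by apply: (scal1 ringS eS czP e_free).
have brLM := brM_lie ringS eS czP e_free brL1.
have gLM := gammaM_lie ringS eS czP e_free brL1 gL1.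
have g_act c x : c \in S -> gammaM g1 (act c x) = act c (gammaM g1 x).
  exact: (gammaM_scal ringS eS czP e_free gL1).
have br_actl c x y : c \in S ->
    brM e cz br1 (act c x) y = act c (brM e cz br1 x y).
  exact: (brM_scall ringS eS czP e_free brL1).
have br_actr c x y : c \in S ->
    brM e cz br1 x (act c y) = act c (brM e cz br1 x y).
  exact: (brM_scalr ringS eS czP e_free brL1).
have annih := annihilates_foldl ringS actDr actDl actM act1 gLM.1 g_act
  (subring_int ringS _) (rC_factor r) (lead_coef_neq0 r_nc)
  (size_roots_gt0 r_nc) rsS (gammaM_annihilates rg1).
have S1 : 1 \in S by case: ringS.
exists (M : zmodType), (brM e cz br1), (component act
  (fun x => gammaM g1 x *~ lead_coef r) (undup (roots_mult r)) (fun t => a * t)).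
(* The embedding is x ↦ x ⊗ 1; it respects brackets because 1 · 1 = 1, and is injective by
   [pure1_inj] since S consists of algebraic integers. *)
exists (fun x => pure cz (j x) 1); split=> //.
- have ga : unit_at S (D * P) a by apply: unit_at_lead_coef.
  have gd := unit_at_root_diff r_nc P ringS rsS DE.
  have gp := unit_at_root_prod r_nc ringS rsS DE PE.
  exact: (eigenspace_grading ringS actDr actDl actM act1 n_injM n_surjM brLM gLM
    g_act br_actl br_actr rsS ga gd gp annih).
- move=> s [x [[[sU _]|->]]]; last by rewrite eqxx.
  by rewrite root_rC // -mem_undup.
split.
- by move=> x y; rewrite jD pureDl.
- by move=> x y; rewrite (brM_pure ringS eS czP e_free brL1) // mulr1 jbr.
move=> x y /eqP; rewrite -subr_eq0 -(additiveB (pureDl cz 1)) -(additiveB jD).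
move=> /eqP/(pure1_inj ringS eS czP SA); rewrite (additiveB jD) => /eqP.
by rewrite subr_eq0 => /eqP/j_inj.
Qed.

Theorem theorem5p2 (L : zmodType) (br : L -> L -> L) (gamma : L -> L)
    (r : {poly int}) (D P : int) :
  is_lie_ring br -> lie_endo br gamma -> poly_annihilates r gamma ->
  D%:~R = discr_star r -> P%:~R = prod_star r ->
  ~ has_torsion L (D * P) ->
  exists (K : zmodType) (brK : K -> K -> K) (Ks : algC -> K -> Prop) (f : L -> K),
    [/\ is_lie_ring brK, is_grading brK Ks,
        (forall s, in_support Ks s -> root (rC r) s) &
      [/\
        (forall x y, in_mulL D x -> in_mulL D y -> f (x + y) = f x + f y),
        (forall x y, in_mulL D x -> in_mulL D y -> f (br x y) = brK (f x) (f y)) &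
        (forall x y, in_mulL D x -> in_mulL D y -> f x = f y -> x = y)]].
Proof.
move=> brL gL rg DE PE no_tors.
have [K [brK [Ks [f [KL Kgr Ksup [fD fbr f_inj]]]]]] :
    exists (K : zmodType) (brK : K -> K -> K) (Ks : algC -> K -> Prop)
           (f : L -> K),
    [/\ is_lie_ring brK, is_grading brK Ks,
        (forall s, in_support Ks s -> root (rC r) s) &
     [/\ (forall x y, f (x + y) = f x + f y),
         (forall x y, f (br x y) = brK (f x) (f y)) & injective f]].
  have [r_const|r_nc] := boolP (is_constant r).
    exact: graded_embedding_const DE no_tors.
  exact: graded_embedding brL gL rg DE PE no_tors.
exists K, brK, Ks, f; split=> //; split=> x y _ _; [exact: fD|exact: fbr|].
exact: f_inj.
Qed.
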